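(* Let $f(x,y)=(2x+y,\,x+y)\bmod 1$ be Thom's map, with invariant set $\Lambda=[0,1)^2\subset\mathbb{R}^2$ and invariant measure $\nu$ equal to Lebesgue measure on $\Lambda$. Let $a,b>0$ and, for $p_M=(x_M,y_M)\in\mathbb{R}^2$, let $\phi_{a,b}:\mathbb{R}^2\to\mathbb{R}$ be the observable $\phi_{a,b}(x,y)=1-|x-x_M|^a-|y-y_M|^b$. Let $\xi$ be the tail index of the GEV limit distribution associated to the process $M_n=\max(X_1,\dots,X_n)$ with $X_n=\phi_{a,b}\circ f^n$. Then for $\nu$-almost every $p_M=(x_M,y_M)\in\Lambda$ we have $$-\frac1\xi=\frac1a+\frac1b .$$
   Context: The map $f$ is regarded as a map of $\mathbb{R}^2$ (reduction mod 1 takes values in $[0,1)^2$) having $\Lambda=[0,1)^2$ as invariant set; the process $X_n=\phi\circ f^n$ is considered on the probability space $(\Lambda,\nu)$, with $\nu$ Lebesgue measure. Generalised extreme value (GEV) distributions: for $\mu\in\mathbb{R}$, $\sigma>0$, $\xi\in\mathbb{R}$, $G(x)=\exp\left(-\left[1+\xi\frac{x-\mu}{\sigma}\right]^{-1/\xi}\right)$ on the set where $1+\xi\frac{x-\mu}{\sigma}>0$ (with the limit $\xi\to0$ taken when $\xi=0$). The GEV limit distribution associated to the process $M_n$ is the non-degenerate limit $G(x)=\lim_{n\to\infty}\nu\left(a_n(M_n-b_n)\le x\right)$ for suitable sequences $a_n>0$, $b_n\in\mathbb{R}$, and its parameter $\xi$ is called the tail index. For instance a limit of the form $\exp(-\tau(u))$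 with $\tau(u)=c(-u)^{\beta}$ for $u<0$ ($c,\beta>0$) has tail index $\xi=-1/\beta$. *)

(* Defs.v *)
From HB Require Import structures.
From mathcomp Require Import all_boot all_order all_algebra.
From mathcomp Require Import all_classical all_reals all_analysis.

Set Implicit Arguments.
Unset Strict Implicit.
Unset Printing Implicit Defensive.

Import Order.TTheory GRing.Theory Num.Theory.
Import numFieldNormedType.Exports.

Local Open Scope classical_set_scope.
Local Open Scope ring_scope.

(* Distribution function of the GEV law with location mu, scale sigma and tail
   index xi. Where 1 + xi * (x - mu) / sigma <= 0 the point x lies below the
   support (xi > 0) or above it (xi < 0), so the value is 0 or 1; the formula
   for xi = 0 is the limit xi -> 0. *)
Definition gev (R : realType) (mu sigma xi x : R) : R :=
  let s := (x - mu) / sigma in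
  let t := 1 + xi * s in
  if xi == 0 then expR (- expR (- s))
  else if 0 < t then expR (- (t `^ (- (1 / xi))))
  else if 0 < xi then 0 else 1.

(* The maximum of X_1, ..., X_n. For n >= 1 the default value X 1 w is one of
   the terms; the value at n = 0 has no meaning. *)
Definition running_max (T : Type) (R : realType) (X : nat -> T -> R) (n : nat)
    (w : T) : R :=
  \big[Num.max/X 1%N w]_(1 <= i < n.+1) X i w.

(* Every GEV distribution function is continuous, so convergence in law is
   pointwise convergence at every x. *)
Definition gev_limit d (T : measurableType d) (R : realType)
    (P : probability T R) (X : nat -> T -> R) (mu sigma xi : R) : Prop :=
  exists (a_ b_ : nat -> R), (forall n, 0 < a_ n) /\
    forall x : R,
      P [set w | a_ n * (running_max X n w - b_ n) <= x] @[n --> \oo]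
        --> (gev mu sigma xi x)%:E.

Definition tail_index d (T : measurableType d) (R : realType)
    (P : probability T R) (X : nat -> T -> R) (xi : R) : Prop :=
  exists mu sigma : R, 0 < sigma /\ gev_limit P X mu sigma xi.

Section thom.
Context (R : realType).

(* measurableTypeR R is R with its Borel sigma-algebra, the one on which
   lebesgue_measure is declared. *)
Local Notation plane := (measurableTypeR R * measurableTypeR R)%type.

Definition mod1 (x : R) : R := x - (Num.floor x)%:~R.

Definition thom (p : R * R) : R * R :=
  (mod1 (2 * p.1 + p.2), mod1 (p.1 + p.2)).

Definition Lambda : set (R * R) := `[0, 1[ `*` `[0, 1[.

Lemma measurable_Lambda : measurable (Lambda : set plane).
Proof. by apply: measurableX; exact: measurable_itv. Qed.

(* Lebesgue measure on Lambda, as a measure on the plane carried by Lambda. *)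
Definition nu : set plane -> \bar R :=
  mrestr (@lebesgue_measure R \x @lebesgue_measure R)%E measurable_Lambda.

HB.instance Definition _ := Measure.on nu.

Lemma nu_setT : nu [set: plane] = 1%E.
Proof.
have leb01 : lebesgue_measure (`[0%R, 1%R[%classic : set R) = 1%E.
  by rewrite lebesgue_measure_itv /= lte_fin ltr01 oppr0 adde0.
rewrite /nu /mrestr setTI product_measure1E; try exact: measurable_itv.
by transitivity (1 * 1 : \bar R)%E; [congr (_ * _)%E; exact: leb01 | exact: mule1].
Qed.

HB.instance Definition _ := Measure_isProbability.Build _ _ _ nu nu_setT.

Definition phi (a b : R) (pM p : R * R) : R :=
  1 - `|p.1 - pM.1| `^ a - `|p.2 - pM.2| `^ b.

Definition process (a b : R) (pM : R * R) (n : nat) (p : R * R) : R :=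
  phi a b pM (iter n thom p).

End thom.

Arguments nu R : clear implicits.

(* Main.v *)
Require Import Defs.
From HB Require Import structures.
From mathcomp Require Import all_boot all_order all_algebra.
From mathcomp Require Import all_classical all_reals all_analysis.
From mathcomp Require Import measurable_realfun.
From mathcomp Require Import ring lra zify.

Set Implicit Arguments.
Unset Strict Implicit.
Unset Printing Implicit Defensive.

Import Order.TTheory GRing.Theory Num.Theory.
Import numFieldNormedType.Exports.

Local Open Scope classical_set_scope.
Local Open Scope ring_scope.

(** An exceedance of the level [1 - r] at time [i] means
that the orbit visits the target [|x - x_M|^a + |y - y_M|^b < r] at time [i].
For [p_M] in the open square and [r] small this target has measure
[area * r^(1/a + 1/b)] ([pr_target]), so that levels [1 - r] with
[area * r^(1/a + 1/b) = tau / n] should be exceeded about [tau] times among the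
first [n] iterates.  It is shown that the probability of no visit tends to
[exp (- tau)] ([extreme_law]).  With [tau = (- x)^(1/a + 1/b)] this limit is the
GEV law of index [- 1 / (1/a + 1/b)] ([gev_weibull]).

Let [W_k] be the event of no visit at times 1, ..., k.  Invariance of [nu] gives
[nu W_(k+1) = nu W_k - nu (B /\ W_k)] exactly ([prn_avoidsS]), so the exponential
law follows once [nu (B /\ W_k)] is [nu B * nu W_k] up to [o (1/n)], uniformly in
[k <= n] ([hitting_time_law]).  To get this a gap of logarithmic length [t] is
opened after time 0 ([local_correlation]); two estimates are then needed.

- Decorrelation across the gap ([mixing]), for every [p_M].  The event [V] of no
  visit after time [t] is almost unchanged by a translation along the stable
  direction [(1, - (1 + theta))], [theta] the golden ratio conjugate, because the
  translation is contracted by [theta^(2 t)] before it is tested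
  ([avoids_translate]).  Every translation of the torus is such a stable one up to
  a small vertical error, as the lattice has points close to the stable line
  ([stable_decomposition]).  Hence [nu ((B - v) /\ V)] hardly depends on [v], while
  by Fubini its mean over [v] is [nu B * nu V] ([correlation_le]).  The target
  enters through its horizontal and vertical sections, which are intervals
  ([slices_translate]).

- Few returns during the gap, for almost every [p_M] ([ae_return_weight]).  If [p]
  and its [i]-th image are both in the target around [q], then the first
  coordinates of [p] and of that image are close, and this set of [p] is small
  whatever [q] is ([pr_close_return]).  So the measure of the points of the target
  that return, averaged over [q], is much smaller than the measure of the target,
  so much that, multiplied by the number of iterates, it is summable along dyadic
  times.

Uniqueness of the tail index is the convergence of types: if two normalizations
give nondegenerate limits, the quantiles of the two limits are related by an
affine map ([quantiles_equispaced]), and comparing quantiles at four equidistant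
points leaves a single exponent ([tail_index_unique]). *)

(** * The circle and the torus measure *)

Section circle.
Context (R : realType).
Local Notation line := (measurableTypeR R).
Local Notation plane := (measurableTypeR R * measurableTypeR R)%type.
Local Notation leb := (@lebesgue_measure R).

Lemma measurable_addr (c : R) : measurable_fun [set: line] (fun x : line => x + c : line).
Proof. exact: measurable_funD. Qed.

Lemma lebesgue_measure_shift (c : R) (E : set R) : measurable (E : set line) ->
  leb [set x | E (x + c)] = leb E.
Proof.
move=> mE.
pose m := pushforward leb (fun x : line => x + c : line).
suff -> : leb E = m E by [].
pose f := fun x : line => x + c : line.
have mf : measurable_fun [set: line] f by exact: measurable_addr.
pose F : {mfun line >-> line} := HB.pack f (isMeasurableFun.Build _ _ _ _ f mf).
apply: (@lebesgue_measure_unique R (pushforward leb F)) => //= _ [[u v]] _ <-.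
rewrite /pushforward.
have -> : f @^-1` `]u, v] = `]u - c, v - c]%classic.
  by apply/seteqP; split=> x /=; rewrite !in_itv/= /f ltrBlDr lerBrDr.
by rewrite !lebesgue_measure_itv/= !lte_fin ltrD2r -!EFinB opprB addrA subrK.
Qed.

Lemma measurable_unit_itv : measurable (`[0, 1[%classic : set line).
Proof. exact: measurable_itv. Qed.

Definition unif : set line -> \bar R := mrestr leb measurable_unit_itv.

HB.instance Definition _ := Measure.on unif.

Lemma unif_setT : unif [set: line] = 1%E.
Proof.
rewrite /unif /mrestr setTI lebesgue_measure_itv/= lte_fin ltr01.
by rewrite oppr0 adde0.
Qed.

HB.instance Definition _ := Measure_isProbability.Build _ _ _ unif unif_setT.

Lemma nu_prodE (E : set plane) : measurable E -> nu R E = (unif \x unif)%E E.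
Proof.
move=> mE; apply/esym/product_measure_unique => // A1 A2 mA1 mA2.
have e : (A1 `*` A2) `&` @Lambda R =
    (A1 `&` `[0%R, 1%R[) `*` (A2 `&` `[0%R, 1%R[) :> set plane.
  by apply/seteqP; split=> -[x y] /= => [[[? ?] [? ?]]|[[? ?] [? ?]]].
transitivity ((leb \x leb)%E ((A1 `*` A2) `&` @Lambda R)); first by [].
rewrite e.
by rewrite product_measure1E//; apply: measurableI => //; exact: measurable_itv.
Qed.

Lemma nu_xE (E : set plane) : measurable E ->
  nu R E = (\int[unif]_x unif [set y | E (x, y)])%E.
Proof.
move=> mE; rewrite nu_prodE// /product_measure1.
by apply: eq_integral => x _ /=; congr unif; rewrite /xsection; apply/seteqP; split => y /=; rewrite ?inE.
Qed.

Lemma nu_yE (E : set plane) : measurable E ->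
  nu R E = (\int[unif]_y unif [set x | E (x, y)])%E.
Proof.
move=> mE; rewrite nu_prodE//.
transitivity ((unif \x^ unif)%E E).
  by apply: product_measure_unique => // A B mA mB; exact: product_measure2E.
rewrite /product_measure2.
by apply: eq_integral => x _ /=; congr unif; rewrite /ysection; apply/seteqP; split => y /=; rewrite ?inE.
Qed.

Lemma measurable_xsec (E : set plane) x : measurable E ->
  measurable ([set y | E (x, y)] : set line).
Proof.
move=> mE; have := measurable_xsection x mE.
by congr measurable; rewrite /xsection; apply/seteqP; split=> y /=; rewrite ?inE.
Qed.

Lemma measurable_ysec (E : set plane) y : measurable E ->
  measurable ([set x | E (x, y)] : set line).
Proof.
move=> mE; have := measurable_ysection y mE.
by congr measurable; rewrite /ysection; apply/seteqP; split=> x /=; rewrite ?inE.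
Qed.

(** Rotation invariance on the circle, in terms of [1]-periodic sets of the line: a
rotation by [s] splits the unit interval at [1 - s] into two translated pieces. *)
Lemma unif_shift (E : set R) (c : R) : measurable (E : set line) ->
  (forall x (k : int), E (x + k%:~R) = E x) ->
  unif [set x | E (x + c)] = unif E.
Proof.
move=> mE perE; rewrite /unif /mrestr.
pose k := Num.floor c; pose s := c - k%:~R.
have /andP[s0 s1] : 0 <= s < 1.
  have := floor_le c; have := floorD1_gt c; rewrite intrD -/k => ? ?.
  by apply/andP; split; rewrite /s; lra.
have -> : [set x | E (x + c)] = [set x | E (x + s)].
  by apply/seteqP; split=> x /=; rewrite -(perE (x + s) k) /s addrA subrK.
have mEs : measurable ([set x | E (x + s)] : set line).
  have := measurable_addr s measurableT mE.
  by rewrite setTI.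
have split2 F w : measurable (F : set line) -> 0 <= w <= 1 ->
   leb (F `&` `[0, 1[) = (leb (F `&` `[0%R, w[) + leb (F `&` `[w, 1%R[))%E.
  move=> mF /andP[w0 w1].
  rewrite -measureU//=; try by apply: measurableI => //; exact: measurable_itv.
    by rewrite -setIUr -itv_bndbnd_setU//= bnd_simp.
  apply/seteqP; split=> x //= [[_]]; rewrite !in_itv/= => /andP[_ xw] [_ /andP[wx _]].
  by move: xw; rewrite ltNge wx.
rewrite [RHS](split2 _ s) ?s0 ?ltW// (split2 _ (1 - s))//; last first.
  by rewrite subr_ge0 gerBl s0 ltW.
have mI (F : set line) (i : interval line) : measurable F -> measurable (F `&` [set` i]).
  by move=> mF; apply: measurableI => //; exact: measurable_itv.
rewrite -(lebesgue_measure_shift s (mI E `[s, 1[ mE)).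
rewrite -(lebesgue_measure_shift (s - 1) (mI E `[0%R, s[ mE)) addeC.
congr (leb _ + leb _)%E; apply/seteqP; split=> x /=; rewrite !in_itv/=.
- have -> : E (x + (s - 1)) = E (x + s) by rewrite -(perE _ 1) addrA subrK.
  by move=> [Ex /andP[? ?]]; split => //; apply/andP; split; lra.
- have -> : E (x + (s - 1)) = E (x + s) by rewrite -(perE _ 1) addrA subrK.
  by move=> [Ex /andP[? ?]]; split => //; apply/andP; split; lra.
- by move=> [Ex /andP[? ?]]; split => //; apply/andP; split; lra.
- by move=> [Ex /andP[? ?]]; split => //; apply/andP; split; lra.
Qed.

(** Uniform bounds on sections pass to [nu], since [unif] is a probability. *)
Lemma nu_le_xsec (E : set plane) (C : R) : measurable E -> 0 <= C ->
  (forall x, unif [set y | E (x, y)] <= C%:E)%E -> (nu R E <= C%:E)%E.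
Proof.
move=> mE C0 EC; rewrite nu_xE//.
apply: (le_trans (ge0_le_integral _ _ _ _ _ _ (f2 := cst C%:E))) => //=.
- have := measurable_fun_xsection unif mE; congr measurable_fun.
  apply/funext => x /=; congr unif; rewrite /xsection.
  by apply/seteqP; split => y /=; rewrite ?inE.
- by rewrite integral_cst// [X in (_ * X)%E]unif_setT mule1.
Qed.

Lemma nu_le_ysec (E : set plane) (C : R) : measurable E -> 0 <= C ->
  (forall y, unif [set x | E (x, y)] <= C%:E)%E -> (nu R E <= C%:E)%E.
Proof.
move=> mE C0 EC; rewrite nu_yE//.
apply: (le_trans (ge0_le_integral _ _ _ _ _ _ (f2 := cst C%:E))) => //=.
- have := measurable_fun_ysection unif mE; congr measurable_fun.
  apply/funext => x /=; congr unif; rewrite /ysection.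
  by apply/seteqP; split => y /=; rewrite ?inE.
- by rewrite integral_cst// [X in (_ * X)%E]unif_setT mule1.
Qed.

Definition periodic (E : set (R * R)) :=
  forall x y (k l : int), E (x + k%:~R, y + l%:~R) = E (x, y).

(** On each vertical section a shear is a rotation.  Both Thom's map and the
translations of the torus are products of shears, so this gives all the
invariance of [nu] that is used. *)
Lemma nu_shear_y (g : R -> R) (E : set plane) :
  measurable_fun [set: line] (g : line -> line) -> measurable E -> periodic E ->
  nu R [set p | E (p.1, p.2 + g p.1)] = nu R E.
Proof.
move=> mg mE perE; rewrite !nu_xE//.
  apply: eq_integral => x _; apply: (@unif_shift [set y | E (x, y)] (g x)).
    exact: measurable_xsec.
  by move=> y k /=; rewrite -[RHS](perE x y 0 k) addr0.
pose f := fun p : plane => (p.1, p.2 + g p.1) : plane.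
have mf : measurable_fun setT f.
  apply/measurable_fun_pairP; split => /=; first exact: measurable_fst.
  by apply: measurable_funD => //=; apply: measurableT_comp.
by have := mf measurableT E mE; rewrite setTI.
Qed.

Lemma nu_shear_x (g : R -> R) (E : set plane) :
  measurable_fun [set: line] (g : line -> line) -> measurable E -> periodic E ->
  nu R [set p | E (p.1 + g p.2, p.2)] = nu R E.
Proof.
move=> mg mE perE; rewrite !nu_yE//.
  apply: eq_integral => y _; apply: (@unif_shift [set x | E (x, y)] (g y)).
    exact: measurable_ysec.
  by move=> x k /=; rewrite -[RHS](perE x y k 0) addr0.
pose f := fun p : plane => (p.1 + g p.2, p.2) : plane.
have mf : measurable_fun setT f.
  apply/measurable_fun_pairP; split => /=; last exact: measurable_snd.
  by apply: measurable_funD => //=; apply: measurableT_comp.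
by have := mf measurableT E mE; rewrite setTI.
Qed.

End circle.

(** * Real-valued probabilities *)

Section real_probability.
Context d (T : measurableType d) (R : realType) (P : probability T R).
Implicit Types A B : set T.

(** Measures of events as real numbers, for linear arithmetic. *)
Definition pr A : R := fine (P A).

Lemma prE A : measurable A -> P A = (pr A)%:E.
Proof. by move=> mA; rewrite fineK// fin_num_measure. Qed.

Lemma pr_ge0 A : 0 <= pr A.
Proof. exact: fine_ge0. Qed.

Lemma pr_le1 A : measurable A -> pr A <= 1.
Proof. by move=> mA; rewrite -lee_fin -prE// probability_le1. Qed.

Lemma prT : pr setT = 1.
Proof. by rewrite /pr probability_setT. Qed.

Lemma le_pr A B : measurable A -> measurable B -> A `<=` B -> pr A <= pr B.
Proof.
by move=> mA mB AB; rewrite -lee_fin -!prE//; apply: le_measure => //; rewrite inE.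
Qed.

Lemma pr_setU A B : measurable A -> measurable B -> pr (A `|` B) <= pr A + pr B.
Proof.
move=> mA mB; rewrite -lee_fin EFinD -!prE//; last exact: measurableU.
exact: measureU2.
Qed.

Lemma pr_setDI A B : measurable A -> measurable B ->
  pr A = pr (A `\` B) + pr (A `&` B).
Proof.
move=> mA mB; apply: EFin_inj.
by rewrite EFinD -!prE//; [exact: measureDI|exact: measurableI|exact: measurableD].
Qed.

Lemma measurable_setY A B : measurable A -> measurable B -> measurable (A `+` B).
Proof. by move=> mA mB; apply: measurableU; exact: measurableD. Qed.

Lemma pr_dist A B : measurable A -> measurable B -> `|pr A - pr B| <= pr (A `+` B).
Proof.
move=> mA mB; rewrite (pr_setDI mA mB) (pr_setDI mB mA) setIC.
have h1 : pr (A `\` B) <= pr (A `+` B).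
  by apply: le_pr; [exact: measurableD|exact: measurable_setY|left].
have h2 : pr (B `\` A) <= pr (A `+` B).
  by apply: le_pr; [exact: measurableD|exact: measurable_setY|right].
have := pr_ge0 (A `\` B); have := pr_ge0 (B `\` A) => ? ?.
by rewrite ler_norml; apply/andP; split; lra.
Qed.

Lemma pr_bigsetU (A : nat -> set T) (s : seq nat) : (forall i, measurable (A i)) ->
  pr (\big[setU/set0]_(i <- s) A i) <= \sum_(i <- s) pr (A i).
Proof.
move=> mA; elim: s => [|i s IH]; first by rewrite !big_nil /pr measure0.
rewrite !big_cons (le_trans (pr_setU _ _)) ?lerD2l//.
exact: bigsetU_measurable.
Qed.

End real_probability.

(** * Lifting the map to a linear map of the plane *)

Section torus.
Context (R : realType).
Local Notation line := (measurableTypeR R).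
Local Notation plane := (measurableTypeR R * measurableTypeR R)%type.
Local Notation leb := (@lebesgue_measure R).
Local Notation mod1 := (@mod1 R).

Lemma mod1_itv x : 0 <= mod1 x < 1.
Proof.
have /andP := floor_itv x; rewrite intrD /Defs.mod1 => -[? ?].
by apply/andP; split; lra.
Qed.

Lemma mod1D x (k : int) : mod1 (x + k%:~R) = mod1 x.
Proof. by rewrite /Defs.mod1 floorDrz ?intr_int// intrKfloor intrD; ring. Qed.

Lemma mod1_id x : 0 <= x < 1 -> mod1 x = x.
Proof. by move=> x01; rewrite /Defs.mod1 (floor_def (m := 0)) ?subr0// add0r. Qed.

Lemma mod1K x : x = mod1 x + (Num.floor x)%:~R.
Proof. by rewrite /Defs.mod1 subrK. Qed.

Lemma measurable_mod1 : measurable_fun [set: line] (mod1 : line -> line).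
Proof.
apply: measurable_funB => //=.
by apply: nondecreasing_measurable => // x y xy; rewrite ler_int le_floor.
Qed.

(** Reduction mod 1.  Events are pulled back by it to periodic sets of the plane, on
which the dynamics is linear and translations need no reduction. *)
Definition torus (p : R * R) : R * R := (mod1 p.1, mod1 p.2).
(** The linear map of which Thom's map is the reduction. *)
Definition cat_lift (p : R * R) : R * R := (2 * p.1 + p.2, p.1 + p.2).

Lemma torus_Lambda p : Lambda (torus p).
Proof. by split; rewrite /= in_itv/= mod1_itv. Qed.

Lemma torus_id p : Lambda p -> torus p = p.
Proof. by case: p => x y [/=]; rewrite !in_itv/= => ? ?; rewrite /torus !mod1_id. Qed.

Lemma torusD x y (k l : int) : torus (x + k%:~R, y + l%:~R) = torus (x, y).
Proof. by rewrite /torus !mod1D. Qed.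

Lemma thom_torus p : thom (torus p) = torus (cat_lift p).
Proof.
rewrite /thom /torus /cat_lift/= [in RHS](mod1K p.1) [in RHS](mod1K p.2).
set k := Num.floor p.1; set l := Num.floor p.2.
rewrite -(mod1D (2 * mod1 p.1 + mod1 p.2) (k *+ 2 + l)) -(mod1D (mod1 p.1 + mod1 p.2) (k + l)).
by congr (mod1 _, mod1 _); rewrite !intrD; ring.
Qed.

Lemma iter_thom_torus n p : iter n (@thom R) (torus p) = torus (iter n cat_lift p).
Proof. by elim: n => //= n ->; rewrite thom_torus. Qed.

Lemma measurable_torus : measurable_fun [set: plane] (torus : plane -> plane).
Proof.
apply/measurable_fun_pairP; split => /=.
  exact: (measurableT_comp measurable_mod1 measurable_fst).
exact: (measurableT_comp measurable_mod1 measurable_snd).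
Qed.

Lemma measurable_cat : measurable_fun [set: plane] (cat_lift : plane -> plane).
Proof.
apply/measurable_fun_pairP; split => /=; apply: measurable_funD => //=.
exact: measurable_funM.
Qed.

Lemma measurable_thom : measurable_fun [set: plane] (@thom R : plane -> plane).
Proof. exact: (measurableT_comp measurable_torus measurable_cat). Qed.

Lemma measurable_iter (f : plane -> plane) n :
  measurable_fun setT f -> measurable_fun setT (iter n f).
Proof.
move=> mf; elim: n => [|n IH]; first exact: measurable_id.
exact: (measurableT_comp mf IH).
Qed.

Lemma measurable_translate (v : R * R) :
  measurable_fun [set: plane] (fun p : plane => (p.1 + v.1, p.2 + v.2) : plane).
Proof. by apply/measurable_fun_pairP; split => /=; apply: measurable_funD. Qed.

Lemma measurable_preimage (f : plane -> plane) (E : set plane) :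
  measurable_fun setT f -> measurable E -> measurable (f @^-1` E).
Proof. by move=> mf mE; rewrite -[_ @^-1` _]setTI; exact: mf. Qed.

Lemma periodic_torus (B : set (R * R)) : periodic (torus @^-1` B).
Proof. by move=> x y k l; rewrite /preimage/= torusD. Qed.

Lemma nu_Lambda (E F : set plane) : E `&` @Lambda R = F `&` @Lambda R -> nu R E = nu R F.
Proof. by rewrite /nu /mrestr => ->. Qed.

Lemma nu_torus (B : set plane) : nu R (torus @^-1` B) = nu R B.
Proof.
apply: nu_Lambda; apply/seteqP; split=> p [Bp Lp]; split => //.
  by rewrite -(torus_id Lp).
by rewrite /preimage/= torus_id.
Qed.

Lemma periodic_cat (E : set (R * R)) : periodic E -> periodic (cat_lift @^-1` E).
Proof.
move=> pE x y k l; rewrite /preimage/= -(pE (2 * x + y) _ (k *+ 2 + l) (k + l)).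
by congr (E (_, _)); rewrite /cat_lift/= !intrD; ring.
Qed.

(** [(x, y) -> (2 x + y, x + y)] is [(x, y) -> (x, x + y)] followed by
[(x, y) -> (x + y, y)]. *)
Lemma nu_cat (E : set plane) : measurable E -> periodic E -> nu R (cat_lift @^-1` E) = nu R E.
Proof.
move=> mE pE.
pose E2 : set plane := [set p | E (p.1 + p.2, p.2)].
have mf : measurable_fun setT (fun p : plane => (p.1 + p.2, p.2) : plane).
  apply/measurable_fun_pairP; split => //=; last exact: measurable_snd.
  exact: (measurable_funD measurable_fst measurable_snd).
have mE2 : measurable E2 by exact: measurable_preimage mf mE.
have pE2 : periodic E2.
  move=> x y k l; rewrite /E2/= -(pE (x + y) y (k + l) l).
  by congr (E (_, _)); rewrite intrD; ring.
transitivity (nu R E2); last first.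
  by apply: (@nu_shear_x _ idfun E) => //; exact: measurable_id.
transitivity (nu R [set p | E2 (p.1, p.2 + idfun p.1)]); last first.
  by apply: nu_shear_y => //; exact: measurable_id.
congr (nu R _); apply/seteqP; split => -[x y]; rewrite /preimage /E2/= /cat_lift/=.
  have -> : 2 * x + y = x + (y + x) by ring.
  by rewrite [y + x]addrC.
have -> : 2 * x + y = x + (y + x) by ring.
by rewrite [y + x]addrC.
Qed.

Lemma preimage_iterS (f : R * R -> R * R) n (E : set (R * R)) :
  iter n.+1 f @^-1` E = f @^-1` (iter n f @^-1` E).
Proof. by apply/funext => p; rewrite /preimage/= -[f (iter n f p)]/(iter n.+1 f p) iterSr. Qed.

Lemma periodic_iter_cat n (E : set (R * R)) : periodic E -> periodic (iter n cat_lift @^-1` E).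
Proof.
move=> pE; elim: n => [//|n IH].
by rewrite preimage_iterS; exact: periodic_cat.
Qed.

Lemma nu_iter_cat n (E : set plane) : measurable E -> periodic E ->
  nu R (iter n cat_lift @^-1` E) = nu R E.
Proof.
move=> mE pE; elim: n => [//|n IH].
rewrite preimage_iterS nu_cat; [exact: IH| |].
- exact: (@measurable_preimage (iter n cat_lift) E (measurable_iter n measurable_cat) mE).
- exact: periodic_iter_cat.
Qed.

Lemma nu_thom (E : set plane) : measurable E -> nu R (@thom R @^-1` E) = nu R E.
Proof.
move=> mE; rewrite -[RHS]nu_torus.
have mT := @measurable_preimage torus E measurable_torus mE.
exact: (nu_cat mT (@periodic_torus E)).
Qed.

Lemma nu_translate (v : R * R) (E : set plane) : measurable E -> periodic E ->
  nu R [set p | E (p.1 + v.1, p.2 + v.2)] = nu R E.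
Proof.
move=> mE pE.
have mE2 : measurable ([set p | E (p.1 + v.1, p.2)] : set plane).
  have := measurable_preimage (measurable_translate (v.1, 0)) mE.
  by congr measurable; apply/seteqP; split => -[x y]; rewrite /preimage/= addr0.
transitivity (nu R [set p | E (p.1 + v.1, p.2)]).
  apply: (@nu_shear_y _ (cst v.2) [set p | E (p.1 + v.1, p.2)]) => //.
by move=> x y k l; rewrite /= addrAC pE.
by apply: (@nu_shear_x _ (cst v.1) E).
Qed.

End torus.

(** * Translations of sets whose sections are intervals *)

Section lipschitz.
Context (R : realType).
Local Notation line := (measurableTypeR R).
Local Notation plane := (measurableTypeR R * measurableTypeR R)%type.
Local Notation leb := (@lebesgue_measure R).
Local Notation mod1 := (@mod1 R).
Local Notation prn := (pr (nu R)).

Lemma leb_itv_le (u v C : R) : 0 <= C -> v - u <= C ->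
  (leb `[u, v]%classic <= C%:E)%E.
Proof.
move=> C0 uvC; rewrite lebesgue_measure_itv/= lte_fin.
by case: ifPn => _; rewrite -?EFinB lee_fin.
Qed.

Lemma leb_le_itvs n (E : set line) (u v : nat -> R) (C : R) :
  measurable E -> 0 <= C -> (forall i, v i - u i <= C) ->
  E `<=` \bigcup_(i in `I_n) `[u i, v i]%classic ->
  (leb E <= (n%:R * C)%:E)%E.
Proof.
move=> mE C0 uvC; rewrite bigcup_mkord => EU.
have mI i : measurable (`[u i, v i]%classic : set line) by exact: measurable_itv.
apply: (@le_trans _ _ (leb (\big[setU/set0]_(i < n) `[u i, v i]%classic))).
  by apply: le_measure; rewrite ?inE//; exact: bigsetU_measurable.
apply: (le_trans (@Boole_inequality _ _ _ leb (fun i => `[u i, v i]%classic) n _)) => //.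
apply: (@le_trans _ _ (\sum_(i < n) C%:E)%E).
  by apply: lee_sum => i _; exact: leb_itv_le.
by rewrite sumEFin sumr_const card_ord mulr_natl.
Qed.

Lemma measurable_mod1_ball (z rho c : R) :
  measurable ([set y | `|mod1 (y + c) - z| < rho] : set line).
Proof.
have mf : measurable_fun [set: line] (fun y : line => `|mod1 (y + c) - z| : line).
  apply: measurableT_comp => //; apply: measurable_funB => //.
  exact: (measurableT_comp (@measurable_mod1 R) (measurable_addr c)).
have := mf measurableT `]-oo, rho[%classic (measurable_itv _).
by rewrite setTI; congr measurable; apply/seteqP; split=> y /=; rewrite in_itv.
Qed.

(** A rotation by [c] can change membership in an interval only near its two end
points and, because of the reduction mod 1, near 0 and 1: four intervals of
length at most [2 |c|]. *)
Lemma unif_ball_shift (z rho c : R) :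
  (unif ([set y : R | (`|mod1 y - z| < rho)%R] `+`
         [set y | (`|mod1 (y + c) - z| < rho)%R]) <= (8 * `|c|)%:E)%E.
Proof.
have m0 := measurable_mod1_ball z rho c.
have m1 := measurable_mod1_ball z rho 0.
have {}m1 : measurable ([set y | `|mod1 y - z| < rho] : set line).
  by move: m1; congr measurable; apply/seteqP; split => y /=; rewrite addr0.
have cc := ler_norm c; have := ler_norm (- c); rewrite normrN => cN.
have := normr_ge0 c; set e := `|c| in cc cN * => e0; clearbody e.
pose u := nth 0 [:: 0; 1 - e; z + rho - e; z - rho - e].
pose v := nth 0 [:: e; 1; z + rho + e; z - rho + e].
rewrite (_ : 8 * e = 4%:R * (2 * e)); last by ring.
apply: (@leb_le_itvs 4 _ u v).
- apply: measurableI; last exact: measurable_itv.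
  exact: measurable_setY.
- by rewrite mulr_ge0.
- by case=> [|[|[|[|i]]]]; rewrite /u /v/= ?nth_nil; lra.
move=> y []; rewrite /= in_itv/= => H /andP[y0 y1].
have [yc0|yc0] := ltP (y + c) 0.
  by exists 0%N => //; rewrite /u /v/= in_itv/=; apply/andP; split; lra.
have [yc1|yc1] := leP 1 (y + c).
  by exists 1%N => //; rewrite /u /v/= in_itv/=; apply/andP; split; lra.
move: H; rewrite !mod1_id ?yc0 ?y0//.
have key : forall s t : R, `|s - t| <= e -> `|s - z| < rho -> ~ `|t - z| < rho ->
    ((z + rho - e <= s <= z + rho + e) /\ (z + rho - e <= t <= z + rho + e)) \/
    ((z - rho - e <= s <= z - rho + e) /\ (z - rho - e <= t <= z - rho + e)).
  move=> s t; rewrite ler_norml ltr_norml => /andP[? ?] /andP[? ?] /negP.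
  rewrite -leNgt ler_normr => /orP[?|?]; [left|right].
    by split; apply/andP; split; lra.
  by split; apply/andP; split; lra.
have ey : `|y - (y + c)| <= e by rewrite ler_norml; apply/andP; split; lra.
have ey' : `|(y + c) - y| <= e by rewrite distrC.
case=> -[] /key h1 /h1 => [/(_ ey)|/(_ ey')] [[h h']|[h h']].
- by exists 2%N => //; rewrite /u /v/= in_itv/=.
- by exists 3%N => //; rewrite /u /v/= in_itv/=.
- by exists 2%N => //; rewrite /u /v/= in_itv/=.
- by exists 3%N => //; rewrite /u /v/= in_itv/=.
Qed.

Definition translate (v : R * R) (E : set (R * R)) : set (R * R) :=
  [set p | E (p.1 + v.1, p.2 + v.2)].

Lemma measurable_translate_set v (E : set plane) : measurable E ->
  measurable (translate v E : set plane).
Proof. exact: (measurable_preimage (measurable_translate v)). Qed.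

Lemma periodic_translate v (E : set (R * R)) : periodic E -> periodic (translate v E).
Proof. by move=> pE x y k l; rewrite /translate/= ![_ + _%:~R + _]addrAC pE. Qed.

Lemma periodic_setY (E F : set (R * R)) : periodic E -> periodic F -> periodic (E `+` F).
Proof. by move=> pE pF x y k l; rewrite /setY/setD/setU/mkset pE pF. Qed.

Lemma translateD v w (E : set (R * R)) :
  translate v (translate w E) = translate (v.1 + w.1, v.2 + w.2) E.
Proof. by apply/funext=> p; rewrite /translate/= !addrA. Qed.

Lemma pr_translate v (E : set plane) : measurable E -> periodic E ->
  prn (translate v E) = prn E.
Proof. by move=> mE pE; congr fine; exact: nu_translate. Qed.

(** A nonpositive radius gives the empty section.  Convexity would be too
strong: the targets are not convex when [a < 1] or [b < 1]. *)
Definition slices (B : set (R * R)) :=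
  (forall x, exists z rho, forall y, B (x, y) <-> `|y - z| < rho) /\
  (forall y, exists z rho, forall x, B (x, y) <-> `|x - z| < rho).

(** A translation is a horizontal one followed by a vertical one, and each of these
moves the sections as in [unif_ball_shift]. *)
Lemma slices_translate (B : set plane) (v : R * R) : measurable B -> slices B ->
  prn ((@torus R @^-1` B) `+` translate v (@torus R @^-1` B)) <= 8 * (`|v.1| + `|v.2|).
Proof.
move=> mB [Bx By]; set T := @torus R @^-1` B.
have mT : measurable (T : set plane) := measurable_preimage (@measurable_torus R) mB.
have pT : periodic T := @periodic_torus R B.
have mTv w := measurable_translate_set w mT.
have mY w : measurable (T `+` translate w T : set plane) by exact: measurable_setY.
have vert c : prn (T `+` translate (0, c) T) <= 8 * `|c|.
  rewrite -lee_fin -prE//; apply: nu_le_xsec => // x.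
  have [z [rho zrho]] := Bx (mod1 x).
  have := unif_ball_shift z rho c; congr (unif _ <= _)%E.
  rewrite /T /preimage /translate /setY /setD /torus/=.
  by apply/seteqP; split=> y/=; rewrite addr0 !zrho.
have horiz c : prn (T `+` translate (c, 0) T) <= 8 * `|c|.
  rewrite -lee_fin -prE//; apply: nu_le_ysec => // y.
  have [z [rho zrho]] := By (mod1 y).
  have := unif_ball_shift z rho c; congr (unif _ <= _)%E.
  rewrite /T /preimage /translate /setY /setD /torus/=.
  by apply/seteqP; split=> x/=; rewrite addr0 !zrho.
rewrite mulrDr.
apply: (@le_trans _ _ (prn (T `+` translate (v.1, 0) T) +
   prn (translate (v.1, 0) (T `+` translate (0, v.2) T)))); last first.
  by rewrite pr_translate ?lerD//; apply: periodic_setY => //; exact: periodic_translate.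
have mm := measurable_translate_set (v.1, 0) (mY (0, v.2)).
apply: le_trans (pr_setU _ (mY _) mm).
apply: le_pr => //; first exact: measurableU.
have -> : translate v T = translate (v.1, 0) (translate (0, v.2) T).
  by rewrite translateD/= addr0 add0r -surjective_pairing.
move=> p; rewrite /setY/setD/setU/translate/=.
by case: (pselect (T (p.1 + v.1, p.2 + 0))); tauto.
Qed.

End lipschitz.

(** * The exceedance sets and their measure *)

Section target.
Context (R : realType).
Local Notation line := (measurableTypeR R).
Local Notation plane := (measurableTypeR R * measurableTypeR R)%type.
Local Notation leb := (@lebesgue_measure R).
Local Notation prn := (pr (nu R)).

Lemma measurable_affine (q s : R) :
  measurable_fun [set: line] (fun x : line => (x - q) / s : line).
Proof. by apply: measurable_funM => //; exact: measurable_funD. Qed.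

Lemma lebesgue_measure_affine (q s : R) (E : set R) : 0 < s -> measurable (E : set line) ->
  leb [set x | E ((x - q) / s)] = (s%:E * leb E)%E.
Proof.
move=> s0 mE; pose f := fun x : line => (x - q) / s : line.
have mf : measurable_fun [set: line] f by exact: measurable_affine.
pose F : {mfun line >-> line} := HB.pack f (isMeasurableFun.Build _ _ _ _ f mf).
have si0 : 0 <= s^-1 by rewrite invr_ge0 ltW.
suff -> : leb E = (s^-1%:E * leb [set x | E ((x - q) / s)%R])%E.
  by rewrite muleA -EFinM divff ?gt_eqF// mul1e.
apply: (@lebesgue_measure_unique R (mscale (NngNum si0) (pushforward leb F))) => //= _ [[u v]] _ <-.
transitivity (s^-1%:E * leb (f @^-1` `]u, v]))%E; last by [].
have -> : f @^-1` `]u, v] = `]u * s + q, v * s + q]%classic.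
  apply/seteqP; split=> x /=; rewrite !in_itv/= /f ltr_pdivlMr// ler_pdivrMr//.
    by move=> /andP[? ?]; apply/andP; split; lra.
  by move=> /andP[? ?]; apply/andP; split; lra.
rewrite !lebesgue_measure_itv/= !lte_fin ltrD2r ltr_pM2r//.
case: ifPn => _; last by rewrite mule0.
by rewrite -!EFinB -EFinM; congr EFin; field; rewrite gt_eqF.
Qed.

(** By uniqueness of the product measure it suffices to look at rectangles. *)
Lemma area_affine (q1 q2 s t : R) (E : set plane) : 0 < s -> 0 < t -> measurable E ->
  (leb \x leb)%E [set p | E ((p.1 - q1) / s, (p.2 - q2) / t)] =
  ((s * t)%:E * (leb \x leb) E)%E.
Proof.
move=> s0 t0 mE; pose f := fun p : plane => ((p.1 - q1) / s, (p.2 - q2) / t) : plane.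
have mf : measurable_fun [set: plane] f.
  apply/measurable_fun_pairP; split => /=.
    exact: (measurableT_comp (measurable_affine q1 s) measurable_fst).
  exact: (measurableT_comp (measurable_affine q2 t) measurable_snd).
pose F : {mfun plane >-> plane} := HB.pack f (isMeasurableFun.Build _ _ _ _ f mf).
have st0 : 0 < s * t by exact: mulr_gt0.
have si0 : 0 <= (s * t)^-1 by rewrite invr_ge0 ltW.
suff -> : (leb \x leb)%E E =
    ((s * t)^-1%:E * (leb \x leb) [set p | E (((p.1 - q1) / s)%R, ((p.2 - q2) / t)%R)])%E.
  by rewrite muleA -EFinM divff ?gt_eqF// mul1e.
apply: (@product_measure_unique _ _ line line R leb leb (mscale (NngNum si0) (pushforward (leb \x leb)%E F))) => // A B mA mB.
transitivity ((s * t)^-1%:E * (leb \x leb) (f @^-1` (A `*` B)))%E; first by [].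
have -> : f @^-1` (A `*` B) = [set x | A ((x - q1) / s)] `*` [set y | B ((y - q2) / t)].
  by [].
have mA' : measurable ([set x | A ((x - q1) / s)] : set line).
  by have := measurable_affine q1 s measurableT mA; rewrite setTI.
have mB' : measurable ([set x | B ((x - q2) / t)] : set line).
  by have := measurable_affine q2 t measurableT mB; rewrite setTI.
rewrite product_measure1E//.
transitivity ((s * t)^-1%:E * ((s%:E * leb A) * (t%:E * leb B)))%E.
  congr (_ * (_ * _))%E.
    exact: (lebesgue_measure_affine q1 s0 mA).
  exact: (lebesgue_measure_affine q2 t0 mB).
by rewrite muleACA !muleA -!EFinM -[X in X%:E]mulrA mulVf ?gt_eqF// mul1e.
Qed.

Context (a b : R) (ha : 0 < a) (hb : 0 < b).

(** Points where the observable of centre [q] exceeds [1 - r]. *)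
Definition target (q : R * R) (r : R) : set (R * R) :=
  [set p | `|p.1 - q.1| `^ a + `|p.2 - q.2| `^ b < r].

Lemma measurable_target q r : measurable (target q r : set plane).
Proof.
have mpow (e z : R) : measurable_fun [set: line] (fun x : line => `|x - z| `^ e : line).
  apply: (measurableT_comp (@measurable_powR R e)).
  by apply: measurableT_comp => //; exact: measurable_funD.
have mf : measurable_fun [set: plane] (fun p : plane => `|p.1 - q.1| `^ a + `|p.2 - q.2| `^ b : line).
  apply: measurable_funD.
    exact: (measurableT_comp (mpow a q.1) measurable_fst).
  exact: (measurableT_comp (mpow b q.2) measurable_snd).
have := mf measurableT `]-oo, r[%classic (measurable_itv _).
by rewrite setTI; congr measurable; apply/seteqP; split=> y /=; rewrite in_itv.
Qed.

Lemma powRVK (e r : R) : 0 < e -> 0 <= r -> (r `^ (1 / e)) `^ e = r.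
Proof. by move=> e0 r0; rewrite -powRrM mul1r mulVf ?gt_eqF// powRr1. Qed.

Lemma powR_lt (x e r : R) : 0 < e -> 0 <= x -> 0 <= r -> (x `^ e < r) = (x < r `^ (1 / e)).
Proof.
move=> e0 x0 r0; rewrite -[in LHS](powRVK e0 r0).
apply/idP/idP; last by apply: gt0_ltr_powR; rewrite ?nnegrE ?powR_ge0.
apply: contraTT; rewrite -!leNgt => h.
by apply: ge0_ler_powR; rewrite ?nnegrE ?powR_ge0// ltW.
Qed.

(** Sections of a target are balls; the value 0 is the radius of an empty section. *)
Lemma powR_add_lt (x e s r : R) : 0 < e -> 0 <= x ->
  (x `^ e + s < r) = (x < if s <= r then (r - s) `^ (1 / e) else 0).
Proof.
move=> e0 x0; case: ifPn => [sr|]; first by rewrite -powR_lt ?subr_ge0// ltrBrDr.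
rewrite -ltNge => rs; rewrite [x < 0]ltNge x0 /=; apply/negbTE; rewrite -leNgt.
by have := powR_ge0 x e; lra.
Qed.

Lemma slices_target q r : slices (target q r).
Proof.
split=> [x|y].
  pose s := `|x - q.1| `^ a.
  exists q.2, (if s <= r then (r - s) `^ (1 / b) else 0) => y.
  by rewrite /target/= addrC powR_add_lt.
pose s := `|y - q.2| `^ b.
exists q.1, (if s <= r then (r - s) `^ (1 / a) else 0) => x.
by rewrite /target/= powR_add_lt.
Qed.

Lemma target_box q r p : 0 <= r -> target q r p ->
  `|p.1 - q.1| < r `^ (1 / a) /\ `|p.2 - q.2| < r `^ (1 / b).
Proof.
move=> r0; rewrite /target/= => h; rewrite -!powR_lt//; split; apply: le_lt_trans h.
  by rewrite lerDl powR_ge0.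
by rewrite lerDr powR_ge0.
Qed.

Definition area : R := fine ((leb \x leb)%E (target (0, 0) 1)).

Lemma areaE : (leb \x leb)%E (target (0, 0) 1) = area%:E.
Proof.
rewrite /area fineK// ge0_fin_numE//.
pose I : set R := `[-1, 1]%classic.
have mI : measurable (I : set line) by exact: measurable_itv.
apply: (@le_lt_trans _ _ ((leb \x leb)%E (I `*` I))).
  apply: le_measure; rewrite ?inE; [exact: measurable_target|exact: measurableX|].
  move=> p /(target_box ler01); rewrite !subr0 !powR1 !ltr_norml.
  by move=> [/andP[? ?] /andP[? ?]]; split; rewrite /I/= in_itv/= !ltW.
have -> : (leb \x leb)%E (I `*` I) = (leb I * leb I)%E by exact: product_measure1E.
have -> : leb I = (1 - -1)%:E.
  by rewrite lebesgue_measure_itv/= lte_fin (_ : -1 < 1 = true)//; apply/idP; lra.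
by rewrite -EFinM ltry.
Qed.

Lemma area_gt0 : 0 < area.
Proof.
pose J e : set R := `[0, (1 / 2) `^ (1 / e)[%classic.
have mJ e : measurable (J e : set line) by exact: measurable_itv.
have h2 : 0 < 1 / 2 :> R by lra.
rewrite -lte_fin -areaE.
apply: (@lt_le_trans _ _ ((leb \x leb)%E (J a `*` J b))).
  have -> : (leb \x leb)%E (J a `*` J b) = (leb (J a) * leb (J b))%E.
    exact: product_measure1E.
  have lJ e : leb (J e) = ((1 / 2) `^ (1 / e))%:E.
    by rewrite lebesgue_measure_itv/= lte_fin powR_gt0// oppr0 adde0.
  by rewrite !lJ -EFinM lte_fin mulr_gt0 ?powR_gt0.
apply: le_measure; rewrite ?inE; [exact: measurableX|exact: measurable_target|].
move=> p []; rewrite /J/= !in_itv/= => /andP[x0 x1] /andP[y0 y1].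
rewrite /target/= !subr0 !ger0_norm//.
rewrite -(powR_lt ha x0 (ltW h2)) in x1.
rewrite -(powR_lt hb y0 (ltW h2)) in y1.
by lra.
Qed.

Definition tail_exponent : R := 1 / a + 1 / b.

Lemma tail_exponent_gt0 : 0 < tail_exponent.
Proof. by rewrite addr_gt0// divr_gt0. Qed.

(** An affine change of variables maps the target onto the unit one. *)
Lemma pr_target q r : 0 < r -> target q r `<=` @Lambda R ->
  prn (target q r) = area * r `^ tail_exponent.
Proof.
move=> r0 tL; have e2 : nu R (target q r) = (leb \x leb)%E (target q r).
  transitivity ((leb \x leb)%E (target q r `&` @Lambda R)); first by [].
  by rewrite (setIidl tL).
have e1 : target q r = [set p | target (0, 0) 1 ((p.1 - q.1) / r `^ (1 / a), (p.2 - q.2) / r `^ (1 / b))].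
  have div_pow e x : 0 < e -> `|x / r `^ (1 / e)| `^ e = `|x| `^ e / r.
    move=> e0; rewrite normrM powRM// normfV (ger0_norm (powR_ge0 _ _)).
    by rewrite -(powR_inv1 (powR_ge0 r _)) powRAC (powRVK e0 (ltW r0)) (powR_inv1 (ltW r0)).
  apply/seteqP; split => p; rewrite /target/= !subr0 !div_pow// -mulrDl.
    by rewrite ltr_pdivrMr// mul1r.
  by rewrite ltr_pdivrMr// mul1r.
have rp e : 0 < r `^ (1 / e) by exact: powR_gt0.
have := area_affine q.1 q.2 (rp a) (rp b) (measurable_target (0, 0) 1).
rewrite -e1 areaE -EFinM -e2 => e3.
apply: (etrans (congr1 fine e3)); rewrite /= mulrC /tail_exponent powRD//.
by apply/implyP => _; rewrite gt_eqF.
Qed.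

End target.

#[local] Opaque nu.

Lemma fubini_sections d1 d2 (T1 : measurableType d1) (T2 : measurableType d2)
  (R : realType) (m1 : {sigma_finite_measure set T1 -> \bar R})
  (m2 : {sigma_finite_measure set T2 -> \bar R}) (S : set (T1 * T2)) : measurable S ->
  (\int[m1]_x m2 (xsection S x) = \int[m2]_y m1 (ysection S y))%E.
Proof.
move=> mS; have := indic_fubini_tonelli m1 m2 mS.
by rewrite indic_fubini_tonelli_FE// indic_fubini_tonelli_GE.
Qed.

(** * Means over a probability space *)

Section mean.
Context d (T : measurableType d) (R : realType) (P : probability T R).

Lemma integral_cst_indic (c : R) (V : set T) : 0 <= c -> measurable V ->
  (\int[P]_p (c%:E * (\1_V p)%:E) = (c * pr P V)%:E)%E.
Proof.
move=> c0 mV; rewrite ge0_integralZl_EFin//; last exact/measurable_EFinP/measurable_indic.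
by rewrite integral_indic// setIT EFinM -!prE.
Qed.

Lemma mean_close (f : T -> R) (m x eps : R) :
  measurable_fun setT (fun v => (f v)%:E) -> (forall v, 0 <= f v) ->
  (forall v, `|f v - x| <= eps) -> (\int[P]_v (f v)%:E = m%:E)%E -> `|x - m| <= eps.
Proof.
move=> mf f0 close intf.
have cst_int (c : R) : (\int[P]_v (cst c%:E) v = c%:E)%E.
  by rewrite integral_cst// [X in (_ * X)%E]probability_setT mule1.
rewrite ler_distlC; apply/andP; split.
  rewrite -lee_fin -intf -[leLHS]cst_int.
  have [e0|e0] := leP 0 (x - eps).
    apply: ge0_le_integral => //= v _.
    by have := close v; rewrite lee_fin ler_distl => /andP[].
  rewrite cst_int (@le_trans _ _ 0%E)//; first by rewrite lee_fin ltW.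
  by apply: integral_ge0 => v _; rewrite lee_fin.
rewrite -lee_fin -intf -[leRHS]cst_int.
apply: ge0_le_integral => //= [v _|v _].
- by rewrite lee_fin.
- by have := close v; rewrite lee_fin ler_distl => /andP[].
Qed.

End mean.

(** * Decorrelation by stable translations *)

Section mixing.
Context (R : realType).
Local Notation line := (measurableTypeR R).
Local Notation plane := (measurableTypeR R * measurableTypeR R)%type.
Local Notation prn := (pr (nu R)).
Local Notation cat_lift := (@cat_lift R).
Local Notation torus := (@torus R).

Lemma measurable_add2 : measurable_fun [set: plane * plane]
  (fun vp : plane * plane => (vp.2.1 + vp.1.1, vp.2.2 + vp.1.2) : plane).
Proof.
have m1 := @measurable_fst _ _ plane plane; have m2 := @measurable_snd _ _ plane plane.
apply/measurable_fun_pairP; split => /=; apply: measurable_funD.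
- exact: (measurableT_comp measurable_fst m2).
- exact: (measurableT_comp measurable_fst m1).
- exact: (measurableT_comp measurable_snd m2).
- exact: (measurableT_comp measurable_snd m1).
Qed.

(** The mean over [v] of [nu (translate v B /\ V)] is [nu B * nu V] by Fubini, since
for fixed [p] the set of the [v] with [p + v] in [B] is a translate of [B].  So if
this quantity hardly depends on [v], then [B] and [V] are almost independent. *)
Lemma correlation_le (B V : set plane) (eps : R) : measurable B -> measurable V ->
  periodic B ->
  (forall v, `|prn (translate v B `&` V) - prn (B `&` V)| <= eps) ->
  `|prn (B `&` V) - prn B * prn V| <= eps.
Proof.
move=> mB mV pB close.
pose S : set (plane * plane) := [set vp | B (vp.2.1 + vp.1.1, vp.2.2 + vp.1.2)] `&` (snd @^-1` V).
have mS : measurable S.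
  apply: measurableI.
    by have := measurable_add2 measurableT mB; rewrite setTI.
  by have := @measurable_snd _ _ plane plane measurableT V mV; rewrite setTI.
have xS v : xsection S v = translate v B `&` V.
  by apply/seteqP; split => p; rewrite /xsection/= ?inE.
have mv v : measurable (translate v B `&` V : set plane).
  by apply: measurableI => //; exact: measurable_translate_set.
have mF := measurable_fun_xsection (nu R) mS.
have F1 := fubini_sections (nu R) (nu R) mS.
have F2 : (\int[nu R]_p nu R (ysection S p) = (prn B * prn V)%:E)%E.
  transitivity (\int[nu R]_p ((prn B)%:E * (\1_V p)%:E))%E.
    apply: eq_integral => p _ /=.
    have -> : ysection S p = [set v | B (p.1 + v.1, p.2 + v.2) /\ V p].
      by apply/seteqP; split => v; rewrite /ysection/= ?inE.
    rewrite indicE; case: (boolP (p \in V)); rewrite (inE, notin_setE) => Vp.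
      have -> : [set v | B (p.1 + v.1, p.2 + v.2) /\ V p] = translate p B.
        have e v : B (p.1 + v.1, p.2 + v.2) = translate p B v.
          by congr (B (_, _)); exact: addrC.
        apply/seteqP; split => v.
          by case=> H _; rewrite -e; exact: H.
        by move=> H; split; [rewrite e; exact: H|exact: Vp].
      rewrite mule1 -(pr_translate p mB pB); apply: prE.
      exact: measurable_translate_set.
    have -> : [set v | B (p.1 + v.1, p.2 + v.2) /\ V p] = set0.
      by rewrite -subset0 => v [_ /Vp].
    by rewrite mule0 measure0.
  exact: (integral_cst_indic (nu R) (pr_ge0 (nu R) B) mV).
have F3 : (\int[nu R]_v (prn (translate v B `&` V))%:E = (prn B * prn V)%:E)%E.
  rewrite -F2 -F1; apply: eq_integral => v _ /=.
  by rewrite xS prE.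
have mF' : measurable_fun setT (fun v : plane => (prn (translate v B `&` V))%:E).
  suff -> : (fun v : plane => (prn (translate v B `&` V))%:E) = nu R \o xsection S by exact: mF.
  by apply/funext => v; rewrite /= xS -prE.
exact: (mean_close mF' (fun v => pr_ge0 (nu R) (translate v B `&` V)) close F3).
Qed.

(** The positive root of [th^2 + th = 1].  The stable direction of the lift is
[(1, - (1 + th))], with eigenvalue [th^2]. *)
Definition golden : R := (Num.sqrt 5 - 1) / 2.
Local Notation th := golden.

Lemma golden_sqr : th ^+ 2 = 1 - th.
Proof.
rewrite /golden; have : Num.sqrt 5 ^+ 2 = 5 :> R by rewrite sqr_sqrtr.
by set s := Num.sqrt 5 => s5; rewrite expr_div_n sqrrB s5; field.
Qed.

Lemma golden_bounds : 2^-1 <= th <= 1.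
Proof.
rewrite /golden; have : Num.sqrt 5 ^+ 2 = 5 :> R by rewrite sqr_sqrtr.
have : 0 <= Num.sqrt 5 :> R by exact: sqrtr_ge0.
by set s := Num.sqrt 5 => s0 s5; apply/andP; split; nra.
Qed.

(** Powers of [th] are integer combinations of [th] and 1: these are the lattice
points close to the stable line. *)
Lemma golden_pow m : exists a b : int, th ^+ m = a%:~R * th + b%:~R /\
  `|a%:~R| <= 2 ^+ m :> R /\ `|b%:~R| <= 2 ^+ m :> R.
Proof.
elim: m => [|m [a [b [e [ha hb]]]]].
  by exists 0, 1; rewrite expr0 mul0r add0r normr0 normr1.
exists (b - a), a; rewrite exprS e mulrDr mulrCA -expr2 golden_sqr !intrB.
split; first by ring.
split; rewrite exprS; first by rewrite (le_trans (ler_normB _ _))//; lra.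
by have := normr_ge0 (a%:~R : R); lra.
Qed.

(** Modulo the lattice every [v] is a stable vector [u (1, - (1 + th))] plus a tiny
vertical one.  The linear form [(1 + th) x + y] vanishes on the stable direction;
its value at [v] is approximated by a multiple of [th^m], which by [golden_pow] is
its value at a lattice point of controlled size. *)
Lemma stable_decomposition m (v : R * R) : Lambda v ->
  exists (u e : R) (k l : int), [/\ v.1 + k%:~R = u,
    v.2 + l%:~R = - (1 + th) * u + e, `|e| <= th ^+ m & `|u| <= 4 * 4 ^+ m].
Proof.
case: v => x y []; rewrite /= !in_itv/= => /andP[x0 x1] /andP[y0 y1].
have /andP[t1 t2] := golden_bounds.
have [a [b [e [ha hb]]]] := golden_pow m.
have tm : 0 < th ^+ m by apply: exprn_gt0; lra.
pose c := (1 + th) * x + y.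
have c0 : 0 <= c by rewrite /c; nra.
have c3 : c <= 3 by rewrite /c; nra.
pose n := Num.floor (c / th ^+ m).
have /andP[n1 n2] := floor_itv (c / th ^+ m); rewrite -/n intrD in n1 n2.
have n0 : 0 <= n%:~R :> R by rewrite ler0z /n floor_ge0 divr_ge0// ltW.
rewrite ler_pdivlMr// in n1; rewrite ltr_pdivrMr// in n2.
exists (x - n%:~R * a%:~R), (c - n%:~R * th ^+ m), (- (n * a)), (- (n * b) + n * a).
split.
- by rewrite rmorphN/= intrM.
- by rewrite /c e intrD rmorphN/= !intrM; ring.
- by rewrite ger0_norm; lra.
have nb : n%:~R <= 3 * 2 ^+ m :> R.
  have i1 : (2 ^+ m)^-1 <= th ^+ m.
    by rewrite -exprVn lerXn2r// nnegrE; lra.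
  have i2 : 0 < 2 ^+ m :> R by exact: exprn_gt0.
  have : n%:~R * (2 ^+ m)^-1 <= 3 :> R.
    by have := ler_wpM2l n0 i1; lra.
  by rewrite ler_pdivrMr.
have p1 : 1 <= 2 ^+ m :> R by rewrite exprn_ege1// ler1n.
have p4 : 4 ^+ m = 2 ^+ m * 2 ^+ m :> R by rewrite -exprMn; congr (_ ^+ _); ring.
rewrite (le_trans (ler_normB _ _))// normrM (ger0_norm n0) (ger0_norm x0) p4.
have : n%:~R * `|a%:~R| <= 3 * 2 ^+ m * 2 ^+ m :> R by exact: ler_pM.
by nra.
Qed.

Lemma cat_stable (u : R) : cat_lift (u, - (1 + th) * u) = (th ^+ 2 * u, - (1 + th) * (th ^+ 2 * u)).
Proof.
rewrite /cat_lift/= golden_sqr; congr (_, _); first by ring.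
have := golden_sqr; set t := th => e.
have -> : u + - (1 + t) * u = - t * u by ring.
have -> : - (1 + t) * ((1 - t) * u) = (t ^+ 2 - 1) * u by ring.
by rewrite e; ring.
Qed.

Lemma iter_cat_stable i (u : R) : iter i cat_lift (u, - (1 + th) * u) =
  (th ^+ (2 * i) * u, - (1 + th) * (th ^+ (2 * i) * u)).
Proof.
elim: i => [|i IH]; first by rewrite muln0 expr0 mul1r.
by rewrite iterS IH cat_stable mulrA -exprD mulnS.
Qed.

Lemma iter_catD i p v : iter i cat_lift (p.1 + v.1, p.2 + v.2) =
  ((iter i cat_lift p).1 + (iter i cat_lift v).1, (iter i cat_lift p).2 + (iter i cat_lift v).2).
Proof.
elim: i => [//|i IH]; rewrite !iterS IH /cat_lift/=; congr (_, _); ring.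
Qed.

Definition avoids (B : set (R * R)) (t k : nat) : set (R * R) :=
  [set p | forall i, (t < i <= t + k)%N -> ~ B (iter i (@thom R) p)].

Lemma avoids_bigsetU (B : set (R * R)) t k :
  torus @^-1` (avoids B t k) =
  ~` \big[setU/set0]_(i <- iota t.+1 k) (iter i cat_lift @^-1` (torus @^-1` B)).
Proof.
apply/seteqP; split => p; rewrite /preimage/=.
  move=> H; rewrite -bigcup_seq => -[i /=].
  rewrite mem_iota addSn ltnS => /H.
  by rewrite iter_thom_torus.
rewrite -bigcup_seq => H i ik; rewrite iter_thom_torus => Bi; apply: H.
by exists i => //=; rewrite mem_iota addSn ltnS.
Qed.

Lemma measurable_iter_cat i (E : set plane) : measurable E ->
  measurable (iter i cat_lift @^-1` E : set plane).
Proof. exact: (measurable_preimage (measurable_iter i (@measurable_cat R))). Qed.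

Lemma measurable_avoids (B : set plane) t k : measurable B ->
  measurable (avoids B t k : set plane).
Proof.
move=> mB.
have -> : avoids B t k =
    ~` \big[setU/set0]_(i <- iota t.+1 k) (iter i (@thom R) @^-1` B).
  apply/seteqP; split => p; rewrite /=.
    by move=> H; rewrite -bigcup_seq => -[i /=]; rewrite mem_iota addSn ltnS => /H.
  rewrite -bigcup_seq => H i ik Bi; apply: H.
  by exists i => //=; rewrite mem_iota addSn ltnS.
apply: measurableC; apply: bigsetU_measurable => i _.
exact: (measurable_preimage (measurable_iter i (@measurable_thom R)) mB).
Qed.

Lemma pr_torus (B : set plane) : prn (torus @^-1` B) = prn B.
Proof. exact: (congr1 fine (nu_torus B)). Qed.

Lemma pr_iter_cat i (E : set plane) : measurable E -> periodic E ->
  prn (iter i cat_lift @^-1` E) = prn E.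
Proof. move=> mE pE; exact: (congr1 fine (nu_iter_cat i mE pE)). Qed.

Lemma translate_iter_cat i w (E : set (R * R)) :
  iter i cat_lift @^-1` (translate (iter i cat_lift w) E) = translate w (iter i cat_lift @^-1` E).
Proof. by apply/funext => p; rewrite /translate/preimage/mkset iter_catD. Qed.

(** At a time [i > t] the stable translation has shrunk by [th^(2 i) <= 2^(- t)], and
by invariance the measure of the points where it matters is the one bounded in
[slices_translate]; sum over the [k] times. *)
Lemma avoids_translate (B : set plane) t k (u : R) : measurable B -> slices B ->
  prn ((torus @^-1` (avoids B t k)) `+`
    translate (u, - (1 + th) * u) (torus @^-1` (avoids B t k))) <= k%:R * (24 * `|u| * 2^-1 ^+ t).
Proof.
move=> mB sB; set w := (u, _); set V := _ @^-1` _.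
have mT : measurable (torus @^-1` B : set plane) := measurable_preimage (@measurable_torus R) mB.
set T := torus @^-1` B in mT *.
have pT : periodic T := @periodic_torus R B.
have mV : measurable (V : set plane) := measurable_preimage (@measurable_torus R) (measurable_avoids t k mB).
pose D i := iter i cat_lift @^-1` (T `+` translate (iter i cat_lift w) T).
have mD i : measurable (D i : set plane).
  apply: measurable_iter_cat; apply: measurable_setY => //.
  exact: measurable_translate_set.
have /andP[t1 t2] := golden_bounds.
have prD i : (t < i)%N -> prn (D i) <= 24 * `|u| * 2^-1 ^+ t.
  move=> ti; have -> : prn (D i) = prn (T `+` translate (iter i cat_lift w) T).
    apply: pr_iter_cat.
      by apply: measurable_setY => //; exact: measurable_translate_set.
    by apply: periodic_setY => //; exact: periodic_translate.
  apply: (le_trans (slices_translate (iter i cat_lift w) mB sB)).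
  rewrite iter_cat_stable/= !normrM normrN exprM golden_sqr.
  have h : (1 - th) ^+ i <= 2^-1 ^+ t.
    apply: (@le_trans _ _ (2^-1 ^+ i)); first by apply: lerXn2r; rewrite ?nnegrE; lra.
    by apply: ler_wiXn2l; [lra|lra|exact: ltnW].
  have h0 : 0 <= (1 - th) ^+ i by apply: exprn_ge0; lra.
  rewrite (ger0_norm h0) (ger0_norm (_ : 0 <= 1 + th)); last by lra.
  have := normr_ge0 u; set X := (1 - th) ^+ i in h h0 *; set Y := 2^-1 ^+ t in h *.
  move=> u0; have : X * `|u| <= Y * `|u| by exact: ler_wpM2r.
  have : 0 <= X * `|u| by exact: mulr_ge0.
  by move: (X * _) => Z ? ?; nra.
apply: (@le_trans _ _ (prn (\big[setU/set0]_(i <- iota t.+1 k) D i))).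
  apply: le_pr.
  - by apply: measurable_setY => //; exact: measurable_translate_set.
  - exact: bigsetU_measurable.
  have DE i : D i = (iter i cat_lift @^-1` T) `+` translate w (iter i cat_lift @^-1` T).
    by rewrite -translate_iter_cat.
  rewrite /V avoids_bigsetU -!bigcup_seq => p [] [].
    move=> H /contrapT[i ik Ti]; exists i => //; rewrite DE; right; split => // Tp.
    by apply: H; exists i.
  move=> H /contrapT[i ik Ti]; exists i => //; rewrite DE; left; split => // Tp.
  by apply: H; exists i.
apply: (le_trans (pr_bigsetU _ _ _)) => //.
apply: (@le_trans _ _ (\sum_(i <- iota t.+1 k) 24 * `|u| * 2^-1 ^+ t)).
  rewrite big_seq [leRHS]big_seq; apply: ler_sum => i.
  by rewrite mem_iota => /andP[ti _]; exact: prD.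
by rewrite big_const_seq count_predT size_iota iter_addr_0 [leRHS]mulr_natl.
Qed.

Lemma translate_torus (v : R * R) (k l : int) (E : set (R * R)) : periodic E ->
  translate v E = translate (v.1 + k%:~R, v.2 + l%:~R) E.
Proof. by move=> pE; apply/funext => p; rewrite /translate/= !addrA pE. Qed.

Lemma pr_setI_dist (A B C D : set plane) :
  measurable A -> measurable B -> measurable C -> measurable D ->
  `|prn (A `&` B) - prn (C `&` D)| <= prn (C `+` A) + prn (D `+` B).
Proof.
move=> mA mB mC mD.
have mCA : measurable (C `+` A) by exact: measurable_setY.
have mDB : measurable (D `+` B) by exact: measurable_setY.
have mAB : measurable (A `&` B) by exact: measurableI.
have mCD : measurable (C `&` D) by exact: measurableI.
apply: (le_trans (pr_dist _ mAB mCD)); apply: le_trans (pr_setU _ mCA mDB).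
apply: le_pr; [exact: measurable_setY|exact: measurableU|].
move=> p [] /= [[? ?]] => /not_andP[]; tauto.
Qed.

(** After reduction of [v] by [stable_decomposition] with [m = 4 L], invariance under
the stable translation moves the latter from [B] to the event.  The lattice points
have size about [4^(4 L)], so a gap of [16 L] outweighs them: the stable error is
at most [2^L * 4^(4 L) * 2^(- 16 L)] up to a factor, and the vertical one is
[th^(4 L) <= 4^(- L)]. *)
Lemma mixing (B : set plane) L k : measurable B -> slices B -> (k <= 2 ^ L)%N ->
  `|prn (B `&` avoids B (16 * L) k) - prn B * prn (avoids B (16 * L) k)|
   <= 104 * 4^-1 ^+ L.
Proof.
move=> mB sB kL; set t := (16 * L)%N.
have mA := measurable_avoids t k mB.
pose T := torus @^-1` B; pose V := torus @^-1` (avoids B t k).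
have mT : measurable (T : set plane) := measurable_preimage (@measurable_torus R) mB.
have mV : measurable (V : set plane) := measurable_preimage (@measurable_torus R) mA.
have pT : periodic T := @periodic_torus R B.
have pV : periodic V := @periodic_torus R _.
have -> : prn (B `&` avoids B t k) = prn (T `&` V).
  exact/esym/pr_torus.
have -> : prn B = prn T by exact/esym/pr_torus.
have -> : prn (avoids B t k) = prn V by exact/esym/pr_torus.
apply: correlation_le => // v0.
rewrite (_ : translate v0 T = translate (torus v0) T); last first.
  rewrite (translate_torus (torus v0) (Num.floor v0.1) (Num.floor v0.2) pT)/=.
  by rewrite -!mod1K -surjective_pairing.
have [u [e [k' [l' [h1 h2 he hu]]]]] := stable_decomposition (4 * L) (torus_Lambda v0).
rewrite (translate_torus (torus v0) k' l' pT) h1 h2.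
pose w := (u, - (1 + th) * u).
have -> : translate (u, - (1 + th) * u + e) T = translate w (translate (0, e) T).
  by rewrite translateD/= addr0.
have mTe : measurable (translate (0, e) T : set plane) by exact: measurable_translate_set.
have pTe : periodic (translate (0, e) T) by exact: periodic_translate.
pose w' := (- u, - (1 + th) * (- u)).
have -> : prn (translate w (translate (0, e) T) `&` V) =
          prn (translate (0, e) T `&` translate w' V).
  have mA' : measurable (translate w (translate (0, e) T) `&` V : set plane).
    by apply: measurableI => //; exact: measurable_translate_set.
  have pA' : periodic (translate w (translate (0, e) T) `&` V).
    move=> x y kk ll; rewrite /setI/=; have -> := pV x y kk ll.
    by have -> := periodic_translate w pTe x y kk ll.
  have e1 : translate w' (translate w (translate (0, e) T)) = translate (0, e) T.
    rewrite translateD /w /w'; apply/funext => p; rewrite /translate/mkset.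
    by congr (T (_ + _, _ + _)) => /=; ring.
  transitivity (prn (translate w' (translate w (translate (0, e) T)) `&` translate w' V)).
    exact: (esym (pr_translate w' mA' pA')).
  by rewrite e1.
have mVw : measurable (translate w' V : set plane) by exact: measurable_translate_set.
apply: (le_trans (pr_setI_dist mTe mVw mT mV)).
have b1 := slices_translate (0, e) mB sB.
have b2 := avoids_translate t k (- u) mB sB; rewrite -/V -/w' in b2.
rewrite -/T /= normr0 add0r in b1.
have /andP[t1 t2] := golden_bounds.
have h4 : th ^+ (4 * L) <= 4^-1 ^+ L.
  rewrite exprM lerXn2r// ?nnegrE; [apply: exprn_ge0; lra| |].
    lra.
  have -> : th ^+ 4 = (1 - th) ^+ 2 by rewrite -golden_sqr -exprM.
  by nra.
have hk : k%:R <= 2 ^+ L :> R by rewrite -natrX ler_nat.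
rewrite normrN in b2.
set X := 4^-1 ^+ L in h4 *.
have X0 : 0 <= X by exact: exprn_ge0.
have b3 : k%:R * (24 * `|u| * 2^-1 ^+ t) <= 96 * X.
  pose x : R := 2 ^+ L; pose z : R := 2^-1 ^+ L.
  have z0 : 0 <= z by exact: exprn_ge0.
  have z1 : z <= 1 by rewrite exprn_ile1// invf_le1// ler1n.
  have xz : x * z = 1 by rewrite /x /z -exprMn divff// expr1n.
  have -> : X = z ^+ 2 by rewrite /X /z exprAC; congr (_ ^+ _); field.
  have -> : 2^-1 ^+ t = z ^+ 16 by rewrite /z -exprM mulnC.
  have x8 : 4 ^+ (4 * L) = x ^+ 8 :> R.
    have e4 : 4 = 2 ^+ 2 :> R by ring.
    by rewrite /x e4 -!exprM; congr (_ ^+ _); rewrite mulnA mulnC.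
  rewrite x8 in hu.
  apply: (@le_trans _ _ (x * (24 * (4 * x ^+ 8) * z ^+ 16))).
    apply: ler_pM => //; first by rewrite !mulr_ge0// exprn_ge0.
    by rewrite ler_wpM2r ?exprn_ge0// ler_wpM2l.
  have -> : x * (24 * (4 * x ^+ 8) * z ^+ 16) = 96 * ((x * z) ^+ 9 * z ^+ 7) by ring.
  by rewrite xz expr1n mul1r ler_wpM2l// ler_wiXn2l.
have b4 : 8 * `|e| <= 8 * X by lra.
apply: (le_trans (lerD b1 b2)); clear - b3 b4; lra.
Qed.

End mixing.

(** * From decorrelation to the exponential law *)

Section hitting_time.
Context (R : realType).
Local Notation plane := (measurableTypeR R * measurableTypeR R)%type.
Local Notation prn := (pr (nu R)).
Local Notation thom := (@thom R).

(** From [1 + x <= exp x] and [1 - x <= exp (- x)]. *)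
Lemma expRN_approx (x : R) : 0 <= x -> `|1 - x - expR (- x)| <= x ^+ 2.
Proof.
move=> x0; have h1 := expR_ge1Dx x; have h2 := expR_ge1Dx (- x).
have h3 : expR x * expR (- x) = 1 by rewrite expRxMexpNx_1.
have h4 := expR_ge0 (- x).
move: (expR x) (expR (- x)) h1 h2 h3 h4 => e f h1 h2 h3 h4.
rewrite ler_norml; apply/andP; split; last by nra.
have h5 : (1 + x) * f <= 1 by rewrite -h3; apply: ler_wpM2r; lra.
have h6 : 0 < 1 + x by lra.
suff : (1 + x) * f <= (1 + x) * (1 - x + x ^+ 2) by rewrite ler_pM2l// => h; lra.
by apply: (le_trans h5); have := exprn_ge0 3 x0; lra.
Qed.

Lemma prn_preimage_thom t (E : set plane) : measurable E ->
  prn (iter t thom @^-1` E) = prn E.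
Proof.
move=> mE; elim: t => [//|t IH]; rewrite preimage_iterS -IH.
apply: (congr1 fine (nu_thom _)).
exact: (measurable_preimage (measurable_iter t (@measurable_thom R)) mE).
Qed.

Context (B : set plane) (mB : measurable B).
Local Notation W := (avoids B 0).

Lemma avoids_preimage t k : avoids B t k = iter t thom @^-1` W k.
Proof.
apply/seteqP; split => p; rewrite /avoids/preimage/mkset.
  move=> H i /andP[i0 ik]; rewrite -iterD; apply: H.
  by rewrite -[X in (X < _)%N]add0n ltn_add2r i0 addnC leq_add2l.
move=> H i /andP[ti ik]; rewrite -(subnK (ltnW ti)) iterD; apply: H.
by rewrite subn_gt0 ti leq_subLR.
Qed.

Lemma prn_avoids t k : prn (avoids B t k) = prn (W k).
Proof. by rewrite avoids_preimage; apply: prn_preimage_thom; exact: measurable_avoids. Qed.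

(** By invariance [nu (avoids B 1 k) = nu (avoids B 0 k)], and [avoids B 1 k] splits
according to whether [B] is visited at time 1. *)
Lemma prn_avoidsS k : prn (W k.+1) = prn (W k) - prn (B `&` W k).
Proof.
have mW j : measurable (W j : set plane) by exact: measurable_avoids.
have mT : measurable (iter 1 thom @^-1` B : set plane).
  exact: (measurable_preimage (measurable_iter 1 (@measurable_thom R)) mB).
have mA : measurable (avoids B 1 k : set plane) by exact: measurable_avoids.
have e1 : avoids B 1 k `\` (iter 1 thom @^-1` B) = W k.+1.
  apply/seteqP; split => p.
    by move=> [H nB] [|[|i]] // ik; apply: H.
  move=> H; split; last exact: (H 1%N).
  by move=> i /andP[i1 ik]; apply: H; rewrite (ltn_trans _ i1).
have e2 : avoids B 1 k `&` (iter 1 thom @^-1` B) = iter 1 thom @^-1` (B `&` W k).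
  by rewrite avoids_preimage preimage_setI setIC.
have := pr_setDI (nu R) mA mT.
rewrite e1 e2 prn_avoids (prn_preimage_thom 1 (measurableI _ _ mB (mW k))) => ->.
by rewrite addrK.
Qed.

(** Bounds the probability of starting in [B] and visiting it again by time [t]. *)
Definition short_returns t : R := \sum_(i <- iota 1 t) prn (B `&` (iter i thom @^-1` B)).

Lemma decoupling_bound (a c s x y q mix : R) : `|a - x| <= mix ->
  a <= c + s -> c <= a -> x <= y + q -> y <= x -> 0 <= s -> 0 <= q ->
  `|c - y| <= s + mix + q.
Proof. by rewrite !ler_distl => /andP[? ?] *; apply/andP; split; lra. Qed.

(** Forgetting the first [t] times changes [nu (B /\ W_k)] by at most the short
returns and [nu W_k] by at most [t * nu B].  For [k <= t] the truncated difference
[k - t] is 0 and the event on the gap is the whole space. *)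
Lemma local_correlation t k (mix : R) :
  `|prn (B `&` avoids B t (k - t)) - prn B * prn (avoids B t (k - t))| <= mix ->
  `|prn (B `&` W k) - prn B * prn (W k)| <= short_returns t + mix + t%:R * prn B ^+ 2.
Proof.
set V := avoids B t (k - t) => hmix.
have mW : measurable (W k : set plane) by exact: measurable_avoids.
have mV : measurable (V : set plane) by exact: measurable_avoids.
have mI i : measurable (iter i thom @^-1` B : set plane).
  exact: (measurable_preimage (measurable_iter i (@measurable_thom R)) mB).
have mBI i : measurable (B `&` (iter i thom @^-1` B) : set plane) by exact: measurableI.
have WV : W k `<=` V.
  move=> p H i /andP[ti ik]; apply: H; rewrite (leq_ltn_trans _ ti)//= add0n.
  by move: ti ik; lia.
have mBW : measurable (B `&` W k : set plane) by exact: measurableI.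
have mBV : measurable (B `&` V : set plane) by exact: measurableI.
have VW p : V p -> W k p \/ exists2 i, (i \in iota 1 t) & B (iter i thom p).
  move=> Vp; have [Wp|/existsNP[i /not_implyP[/andP[i0 ik] /contrapT Bi]]] := pselect (W k p).
    by left.
  right; exists i => //; rewrite mem_iota i0 add1n ltnS leqNgt.
  by apply/negP => ti; apply: (Vp i) => //; rewrite ti; move: ik; lia.
have s1 : prn (B `&` V) <= prn (B `&` W k) + short_returns t.
  apply: (@le_trans _ _ (prn ((B `&` W k) `|` \big[setU/set0]_(i <- iota 1 t) (B `&` (iter i thom @^-1` B))))).
    have mU : measurable (\big[setU/set0]_(i <- iota 1 t) (B `&` (iter i thom @^-1` B)) : set plane).
      exact: bigsetU_measurable.
    apply: le_pr => //; first exact: measurableU.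
    move=> p [Bp /VW[Wp|[i it Bi]]]; first by left.
    by right; rewrite -bigcup_seq; exists i.
  apply: (le_trans (pr_setU _ _ _)) => //; first exact: bigsetU_measurable.
  by rewrite lerD2l; exact: pr_bigsetU.
have s2 : prn V <= prn (W k) + t%:R * prn B.
  apply: (@le_trans _ _ (prn ((W k) `|` \big[setU/set0]_(i <- iota 1 t) (iter i thom @^-1` B)))).
    have mU : measurable (\big[setU/set0]_(i <- iota 1 t) (iter i thom @^-1` B) : set plane).
      exact: bigsetU_measurable.
    apply: le_pr => //; first exact: measurableU.
    move=> p /VW[Wp|[i it Bi]]; first by left.
    by right; rewrite -bigcup_seq; exists i.
  apply: (le_trans (pr_setU _ _ _)) => //; first exact: bigsetU_measurable.
  rewrite lerD2l; apply: (le_trans (pr_bigsetU _ _ _)) => //.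
  under eq_bigr do rewrite prn_preimage_thom//.
  by rewrite big_const_seq count_predT size_iota iter_addr_0 [leRHS]mulr_natl.
have s3 : prn (B `&` W k) <= prn (B `&` V) by apply: le_pr => //; exact: setIS.
have s4 : prn (W k) <= prn V by exact: le_pr.
have b0 : 0 <= prn B by exact: pr_ge0.
have s5 : prn B * prn V <= prn B * prn (W k) + t%:R * prn B ^+ 2.
  by apply: (le_trans (ler_wpM2l b0 s2)); rewrite mulrDr mulrCA expr2.
have s6 : prn B * prn (W k) <= prn B * prn V by exact: ler_wpM2l.
have s7 : 0 <= short_returns t by apply: sumr_ge0 => i _; exact: pr_ge0.
have s8 : 0 <= t%:R * prn B ^+ 2 by exact: (mulr_ge0 (ler0n _ _) (sqr_ge0 _)).
exact: (decoupling_bound hmix s1 s3 s5 s6 s7 s8).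
Qed.

(** The defect [nu W_k - exp (- k nu B)] is multiplied by at most 1 and increased by
at most [eps + (nu B)^2] at each step. *)
Lemma hitting_time_law n (eps : R) :
  (forall k, (k < n)%N -> `|prn (B `&` W k) - prn B * prn (W k)| <= eps) ->
  `|prn (W n) - expR (- (n%:R * prn B))| <= n%:R * (eps + prn B ^+ 2).
Proof.
set b := prn B.
have b0 : 0 <= b by exact: pr_ge0.
elim: n => [_|n IH H].
  rewrite !mul0r oppr0 expR0.
  have -> : W 0 = setT by apply/seteqP; split => // p _ i; rewrite addn0; case: i.
  by rewrite prT subrr normr0.
have {}IH := IH (fun k kn => H k (leqW kn)).
have {}H := H n (ltnSn n).
have w0 : 0 <= prn (W n) by exact: pr_ge0.
have w1 : prn (W n) <= 1 by apply: pr_le1; exact: measurable_avoids.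
have := expRN_approx b0.
have e1 : expR (- (n.+1%:R * b)) = expR (- b) * expR (- (n%:R * b)).
  by rewrite -expRD -natr1; congr expR; ring.
rewrite prn_avoidsS e1 -natr1.
have : 0 <= expR (- b) by exact: expR_ge0.
have : expR (- b) <= 1 by rewrite -expR0 ler_expR oppr_le0.
move: (expR _) (expR _) (prn (W n)) (prn (B `&` _)) H IH w0 w1 => E f w c H IH w0 w1 E1 E0 hE.
have -> : w - c - E * f = E * (w - f) + (1 - b - E) * w + (b * w - c) by ring.
apply: (le_trans (ler_normD _ _)); apply: (le_trans (lerD (ler_normD _ _) (lexx _))).
rewrite !normrM (ger0_norm E0) (ger0_norm w0) [`|b * w - c|]distrC.
have i1 : E * `|w - f| <= `|w - f| by rewrite ler_piMl.
have i2 : `|1 - b - E| * w <= b ^+ 2 by apply: le_trans hE; rewrite ler_piMr.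
by clear - H IH i1 i2; lra.
Qed.

End hitting_time.

(** * Almost sure convergence from summable means *)

Section summable_means.
Context d (T : measurableType d) (R : realType) (P : probability T R).

(** The sum of the [G n] has finite mean, hence is finite almost everywhere, so its
terms tend to 0 there. *)
Lemma ae_cvg0_geometric_mean (G : nat -> T -> R) (C x : R) :
  (forall n, measurable_fun setT (fun w => (G n w)%:E)) -> (forall n w, 0 <= G n w) ->
  0 <= x < 1 -> 0 <= C ->
  (forall n, \int[P]_w (G n w)%:E <= (C * x ^+ n)%:E)%E ->
  {ae P, forall w, G n w @[n --> \oo] --> 0}.
Proof.
move=> mG G0 /andP[x0 x1] C0 intG.
pose f w := (\sum_(0 <= n <oo) (G n w)%:E)%E.
have f0 w : (0 <= f w)%E by apply: nneseries_ge0 => n _ _; rewrite lee_fin.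
have mf : measurable_fun setT f.
  by apply: ge0_emeasurable_sum => // n w _ _; rewrite lee_fin.
have intf : (\int[P]_w f w < +oo)%E.
  rewrite integral_nneseries//; last by move=> n w _; rewrite lee_fin.
  apply: (@le_lt_trans _ _ (C / (1 - x))%:E); last exact: ltry.
  apply: lime_le.
    by apply: is_cvg_nneseries => n _ _; apply: integral_ge0 => w _; rewrite lee_fin.
  apply: nearW => n; apply: (@le_trans _ _ (\sum_(0 <= i < n) (C * x ^+ i)%:E)%E).
    by apply: lee_sum => i _.
  rewrite sumEFin lee_fin.
  have -> : \sum_(0 <= i < n) C * x ^+ i = series (geometric C x) n by [].
  rewrite geometric_seriesE ?lt_eqF//=.
  apply: ler_wpM2r; first by rewrite invr_ge0 subr_ge0 ltW.
  rewrite ler_piMr// gerBl.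
  exact: exprn_ge0.
have intgf : P.-integrable setT f.
  apply/integrableP; split => //.
  by under eq_integral do rewrite gee0_abs//.
have := integrable_ae measurableT intgf.
apply: filterS => w /(_ Logic.I) fw.
apply: (@cvg_series_cvg_0 _ R^o).
apply: nondecreasing_is_cvgn.
  by apply: nondecreasing_series => n _ _.
exists (fine (f w)) => _ [n _ <-].
rewrite -lee_fin fineK// /series/= -sumEFin.
by apply: nneseries_lim_ge => i _; rewrite lee_fin.
Qed.

End summable_means.

Section bernoulli.
Context (R : realType).

Lemma natmul_le_expr (h : R) n : 0 <= h -> 1 + n%:R * h <= (1 + h) ^+ n.
Proof.
move=> h0; elim: n => [|n IH]; first by rewrite mul0r addr0.
rewrite exprS -natr1; apply: (@le_trans _ _ ((1 + h) * (1 + n%:R * h))).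
  have : 0 <= n%:R * h * h by rewrite !mulr_ge0.
  by move=> ?; lra.
by rewrite ler_wpM2l//; lra.
Qed.

Lemma natmul_geometric (eta : R) : 0 < eta < 1 -> exists C x : R,
  [/\ 0 <= x < 1, 0 <= C & forall n : nat, n%:R * eta ^+ n <= C * x ^+ n].
Proof.
move=> /andP[e0 e1]; pose h := (1 - eta) / (2 * eta).
have h0 : 0 < h by rewrite divr_gt0// ?subr_gt0// mulr_gt0.
exists h^-1, ((1 + eta) / 2); split.
- by apply/andP; split; lra.
- by rewrite invr_ge0 ltW.
move=> n.
have -> : (1 + eta) / 2 = (1 + h) * eta by rewrite /h; field; rewrite gt_eqF.
rewrite exprMn mulrA; apply: ler_wpM2r; first by rewrite exprn_ge0// ltW.
rewrite mulrC ler_pdivlMr//.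
by have := natmul_le_expr n (ltW h0); lra.
Qed.

End bernoulli.

(** * Points that come back close to themselves *)

Section returns.
Context (R : realType).
Local Notation line := (measurableTypeR R).
Local Notation plane := (measurableTypeR R * measurableTypeR R)%type.
Local Notation leb := (@lebesgue_measure R).
Local Notation prn := (pr (nu R)).
Local Notation cat_lift := (@cat_lift R).
Local Notation thom := (@thom R).
Local Notation mod1 := (@mod1 R).

(** The coefficient of the first coordinate is at least 2, so it stays positive after
the identity is subtracted. *)
Lemma iter_cat_fst i : exists n m : nat,
  forall p : R * R, (iter i.+1 cat_lift p).1 = n.+2%:R * p.1 + m%:R * p.2.
Proof.
suff [n [m [k [l H]]]] : exists n m k l : nat, forall p : R * R,
    iter i.+1 cat_lift p = (n.+2%:R * p.1 + m%:R * p.2, k%:R * p.1 + l%:R * p.2).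
  by exists n, m => p; rewrite H.
elim: i => [|i [n [m [k [l IH]]]]].
  by exists 0%N, 1%N, 1%N, 1%N => p; rewrite /= /cat_lift !mul1r.
exists (n.+2 + n + k)%N, (2 * m + l)%N, (n.+2 + k)%N, (m + l)%N => p.
rewrite iterS IH /cat_lift /= -[in n.+2%:R]addn2 -[(n.+2 + n + k).+2]addn2.
by congr (_, _); rewrite !natrD ?natrM; ring.
Qed.

Definition close_return i (h : R) : set (R * R) :=
  [set p | `|(iter i thom p).1 - p.1| < h].

Lemma measurable_close_return i h : measurable (close_return i h : set plane).
Proof.
have mf : measurable_fun [set: plane] (fun p : plane => `|(iter i thom p).1 - p.1| : line).
  apply: measurableT_comp => //; apply: measurable_funB; last exact: measurable_fst.
  exact: (measurableT_comp measurable_fst (measurable_iter i (@measurable_thom R))).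
have := mf measurableT `]-oo, h[%classic (measurable_itv _).
by rewrite setTI; congr measurable; apply/seteqP; split=> y /=; rewrite in_itv.
Qed.

(** If [(n + 2) x + c] is within [h] of [x] mod 1, then [(n + 1) x + c] is within [h] of
an integer: at most [n + 3] intervals of length [2 h / (n + 1)] meet the unit interval. *)
Lemma unif_close_return (n : nat) (c h : R) : 0 < h <= 1 ->
  measurable ([set x | `|mod1 (n.+2%:R * x + c) - x| < h] : set line) ->
  (unif ([set x : R | (`|mod1 (n.+2%:R * x + c) - x| < h)%R]) <= (6 * h)%:E)%E.
Proof.
move=> /andP[h0 h1] mS.
pose D : R := n.+1%:R; have D1 : 1 <= D by rewrite ler1n.
have D0 : 0 < D by lra.
pose k : int := Num.floor c.
have /andP[k1 k2] := floor_itv c; rewrite -/k intrD in k1 k2.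
pose u (i : nat) := (k%:~R + i%:R - c - h) / D.
pose v (i : nat) := (k%:~R + i%:R - c + h) / D.
apply: (@le_trans _ _ (n.+3%:R * (2 * h / D))%:E).
  apply: (@leb_le_itvs _ n.+3 _ u v).
  - by apply: measurableI => //; exact: measurable_itv.
  - by rewrite divr_ge0 ?mulr_ge0// ltW.
  - move=> i; rewrite /u /v -mulrBl; apply: ler_wpM2r; last by lra.
    by rewrite invr_ge0 ltW.
  move=> x []; rewrite /= in_itv/= /Defs.mod1 => + /andP[x0 x1].
  set z := n.+2%:R * x + c; set j := Num.floor z.
  have -> : z - j%:~R - x = D * x + c - j%:~R.
    by rewrite /z /D -[n.+2%:R]natr1; ring.
  rewrite ltr_norml => /andP[j1 j2].
  have Dx0 : 0 <= D * x by rewrite mulr_ge0// ltW.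
  have Dx1 : D * x < D by rewrite gtr_pMr.
  have kj : (k <= j)%R.
    rewrite -ltzD1 -(ltr_int R) intrD; lra.
  have jk : (j - k < n.+3%:Z)%R.
    rewrite -(ltr_int R) intrB; have -> : n.+3%:~R = D + 2 :> R.
      by rewrite /D -pmulrn -addn2 natrD.
    by lra.
  exists `|j - k|%N.
    by rewrite /= -ltz_nat gez0_abs// subr_ge0.
  rewrite /= in_itv/= /u /v.
  have -> : (`|j - k|%N%:R : R) = j%:~R - k%:~R.
    by rewrite pmulrn gez0_abs ?subr_ge0// intrB.
  by rewrite ler_pdivrMr// ler_pdivlMr//; apply/andP; split; lra.
rewrite lee_fin mulrA ler_pdivrMr//.
have -> : n.+3%:R = D + 2 :> R by rewrite /D -addn2 natrD.
by nra.
Qed.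

Lemma pr_close_return i h : 0 < h -> prn (close_return i.+1 h) <= 6 * h.
Proof.
move=> h0; have mC := measurable_close_return i.+1 h.
have [h1|h1] := leP h 1; last first.
  by apply: (le_trans (pr_le1 _ mC)); lra.
have [n [m nm]] := iter_cat_fst i.
pose E : set (R * R) := [set p | `|(torus (iter i.+1 cat_lift p)).1 - p.1| < h].
have mE : measurable (E : set plane).
  have mf : measurable_fun [set: plane] (fun p : plane => `|(torus (iter i.+1 cat_lift p)).1 - p.1| : line).
    apply: measurableT_comp => //; apply: measurable_funB; last exact: measurable_fst.
    have := measurableT_comp (@measurable_torus R) (measurable_iter i.+1 (@measurable_cat R)).
    exact: (measurableT_comp measurable_fst).
  have := mf measurableT `]-oo, h[%classic (measurable_itv _).
  by rewrite setTI; congr measurable; apply/seteqP; split=> y /=; rewrite in_itv.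
have -> : prn (close_return i.+1 h) = prn E.
  apply: (congr1 fine); apply: nu_Lambda; apply/seteqP; split => p [Cp Lp]; split => //.
    by rewrite /E/mkset -iter_thom_torus torus_id.
  by move: Cp; rewrite /E/close_return/mkset -iter_thom_torus torus_id.
rewrite -lee_fin -prE//; apply: nu_le_ysec => // [|y]; first by rewrite mulr_ge0// ltW.
have e : [set x | E (x, y)] = [set x | `|mod1 (n.+2%:R * x + m%:R * y) - x| < h].
  by apply/seteqP; split => x; rewrite /E/mkset/torus nm.
rewrite e; apply: unif_close_return; first by rewrite h0.
by rewrite -e; exact: measurable_ysec.
Qed.

End returns.

Section scaled_sum.
Context d (T : measurableType d) (R : realType) (P : probability T R).

Lemma mean_scaled_sum (c M : R) (s : seq nat) (g : nat -> T -> R) : 0 <= c ->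
  (forall i, measurable_fun setT (g i)) -> (forall i w, 0 <= g i w) ->
  (forall i, i \in s -> \int[P]_w (g i w)%:E <= M%:E)%E ->
  (\int[P]_w (c * \sum_(i <- s) g i w)%:E <= (c * ((size s)%:R * M))%:E)%E.
Proof.
move=> c0 mg g0 intg.
under eq_integral do rewrite EFinM -sumEFin.
rewrite ge0_integralZl_EFin//; last 2 first.
- by move=> w _; apply: sume_ge0 => i _; rewrite lee_fin.
- by apply: emeasurable_sum => i; exact/measurable_EFinP.
rewrite EFinM lee_wpmul2l ?lee_fin// ge0_integral_sum//; last 2 first.
- by move=> i; exact/measurable_EFinP.
- by move=> i w _; rewrite lee_fin.
rewrite big_seq; apply: (@le_trans _ _ (\sum_(i <- s | i \in s) M%:E)%E).
  exact: lee_sum.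
by rewrite -big_seq sumEFin big_const_seq count_predT iter_addr_0 mulr_natl.
Qed.

End scaled_sum.

(** * Short returns for almost every centre *)

Section typical_points.
Context (R : realType).
Local Notation line := (measurableTypeR R).
Local Notation plane := (measurableTypeR R * measurableTypeR R)%type.
Local Notation leb := (@lebesgue_measure R).
Local Notation prn := (pr (nu R)).
Local Notation thom := (@thom R).

Definition box (w1 w2 : R) (q : R * R) : set (R * R) :=
  [set p | `|p.1 - q.1| < w1 /\ `|p.2 - q.2| < w2].

Lemma unif_ball_le (x w : R) : 0 <= w ->
  measurable ([set y | `|x - y| < w] : set line) /\
  (unif [set y : R | (`|x - y| < w)%R] <= (2 * w)%:E)%E.
Proof.
move=> w0.
have e : [set y | `|x - y| < w] = `]x - w, x + w[%classic.
  by apply/seteqP; split=> y /=; rewrite in_itv/= ltr_distlC.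
rewrite e; split; first exact: measurable_itv.
rewrite /unif /mrestr.
apply: (@le_trans _ _ (leb `[x - w, x + w]%classic)); last first.
  by apply: leb_itv_le; [rewrite mulr_ge0|lra].
apply: le_measure; rewrite ?inE.
- by apply: measurableI; exact: measurable_itv.
- exact: measurable_itv.
move=> y [] /=; rewrite !in_itv/= => /andP[? ?] _; apply/andP; split; exact: ltW.
Qed.

Lemma pr_box_le (w1 w2 : R) p : 0 <= w1 -> 0 <= w2 ->
  measurable ([set q | box w1 w2 q p] : set plane) /\
  prn [set q | box w1 w2 q p] <= 4 * (w1 * w2).
Proof.
move=> w10 w20.
have [m1 u1] := unif_ball_le p.1 w10; have [m2 u2] := unif_ball_le p.2 w20.
have e : [set q | box w1 w2 q p] =
  [set y : R | (`|p.1 - y| < w1)%R] `*` [set y : R | (`|p.2 - y| < w2)%R] by [].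
have mB : measurable ([set q | box w1 w2 q p] : set plane).
  by rewrite e; exact: measurableX.
have e2 : nu R [set q | box w1 w2 q p] =
    (unif [set y : R | (`|p.1 - y| < w1)%R] * unif [set y : R | (`|p.2 - y| < w2)%R])%E.
  exact: (etrans (nu_prodE mB) (product_measure1E _ _ m1 m2)).
have le2 : (nu R [set q | box w1 w2 q p] <= (4 * (w1 * w2))%:E)%E.
  rewrite e2; have -> : 4 * (w1 * w2) = (2 * w1) * (2 * w2) by ring.
  by rewrite EFinM; apply: lee_pmul.
by split => //; rewrite -lee_fin -prE.
Qed.

Lemma measurable_box_rel (w1 w2 : R) (D : set plane) : measurable D ->
  measurable ([set qp | box w1 w2 qp.1 qp.2 /\ D qp.2] : set (plane * plane)).
Proof.
move=> mD; have m1 := @measurable_fst _ _ plane plane; have m2 := @measurable_snd _ _ plane plane.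
have mball (f : plane -> line) (w : R) : measurable_fun setT f ->
    measurable [set qp : plane * plane | `|(f qp.2 : R) - f qp.1| < w].
  move=> mf.
  have mg : measurable_fun setT (fun qp : plane * plane => `|(f qp.2 : R) - f qp.1| : line).
    apply: measurableT_comp => //; apply: measurable_funB.
      exact: (measurableT_comp mf m2).
    exact: (measurableT_comp mf m1).
  have := mg measurableT `]-oo, w[%classic (measurable_itv _).
  by rewrite setTI; congr measurable; apply/seteqP; split=> y /=; rewrite in_itv.
have b1 := mball fst w1 measurable_fst; have b2 := mball snd w2 measurable_snd.
have b3 := m2 measurableT D mD; rewrite setTI in b3.
exact: (measurableI _ _ (measurableI _ _ b1 b2) b3).
Qed.

(** By Fubini, integrating first over the centre [q]: a given [p] lies in the boxes
of centres [q] that fill at most measure [4 w1 w2]. *)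
Lemma mean_box (w1 w2 : R) (D : set plane) : 0 <= w1 -> 0 <= w2 -> measurable D ->
  measurable_fun [set: plane] (fun q : plane => prn (box w1 w2 q `&` D)) /\
  (\int[nu R]_q (prn (box w1 w2 q `&` D))%:E <= (4 * (w1 * w2) * prn D)%:E)%E.
Proof.
move=> w10 w20 mD.
pose S : set (plane * plane) := [set qp | box w1 w2 qp.1 qp.2 /\ D qp.2].
have mS : measurable S := measurable_box_rel w1 w2 mD.
have xS q : xsection S q = box w1 w2 q `&` D.
  by apply/seteqP; split => p; rewrite /xsection/= ?inE.
have mx q : measurable (box w1 w2 q `&` D : set plane).
  by rewrite -xS; exact: measurable_xsection.
have eS : (fun q : plane => (prn (box w1 w2 q `&` D))%:E) = nu R \o xsection S.
  by apply/funext => q; rewrite /= xS -prE.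
split; first by apply/measurable_EFinP; rewrite [X in measurable_fun _ X]eS; exact: measurable_fun_xsection.
have -> : (\int[nu R]_q (prn (box w1 w2 q `&` D))%:E = \int[nu R]_q (nu R) (xsection S q))%E.
  by apply: eq_integral => q _; rewrite xS -prE.
rewrite (fubini_sections (nu R) (nu R) mS).
have c0 : 0 <= 4 * (w1 * w2) by rewrite !mulr_ge0.
rewrite -(integral_cst_indic (nu R) c0 mD).
apply: ge0_le_integral.
- exact: measurableT.
- by move=> p _; exact: measure_ge0.
- exact: measurable_fun_ysection.
- apply: measurable_funeM; exact/measurable_EFinP/measurable_indic.
- move=> p _; have [mb pb] := pr_box_le p w10 w20.
  rewrite indicE; case: (boolP (p \in D)); rewrite (inE, notin_setE) => Dp.
    have -> : ysection S p = [set q | box w1 w2 q p].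
      apply/seteqP; split => q; rewrite /ysection/= ?inE; first by case.
      by move=> h; split.
    by move: pb; rewrite -lee_fin -(prE (nu R) mb) mule1; exact.
  have -> : ysection S p = set0.
    by rewrite -subset0 => q; rewrite /ysection/= ?inE => -[_ /Dp].
  by rewrite measure0 mule0.
Qed.

Context (x1 x2 : R) (x10 : 0 < x1) (x20 : 0 < x2) (x12 : 2 * (x1 ^+ 2 * x2) < 1).

(** [2^L] times the sum, over the times [i <= 16 L], of the measures of the points of a
box whose first coordinate comes back near itself at time [i].  The factor [2^L]
stands for the number of iterates, and the sides shrink geometrically in [L]. *)
Definition return_weight L q : R :=
  2 ^+ L * \sum_(i <- iota 1 (16 * L))
    prn (box (x1 ^+ L) (x2 ^+ L) q `&` @close_return R i (2 * x1 ^+ L)).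

(** The mean of the weight is [O (L * (2 * x1^2 * x2)^L)] by [mean_box] and
[pr_close_return], hence summable. *)
Lemma ae_return_weight :
  {ae (nu R), forall q : R * R, return_weight L q @[L --> \oo] --> 0}.
Proof.
pose eta := 2 * (x1 ^+ 2 * x2).
have eta0 : 0 < eta by rewrite !mulr_gt0// exprn_gt0.
have [|C [x [x01 C0 hx]]] := @natmul_geometric R eta; first by rewrite eta0.
have w1 L : 0 <= x1 ^+ L by rewrite exprn_ge0// ltW.
have w2 L : 0 <= x2 ^+ L by rewrite exprn_ge0// ltW.
have mc L i : measurable (@close_return R i (2 * x1 ^+ L) : set plane).
  exact: measurable_close_return.
apply: (@ae_cvg0_geometric_mean _ _ R (nu R) return_weight (16 * 48 * C) x).
- move=> L; apply/measurable_EFinP; apply: measurable_funM => //.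
  by apply: measurable_sum => i; exact: (mean_box (w1 L) (w2 L) (mc L i)).1.
- move=> L q; rewrite mulr_ge0 ?exprn_ge0//; apply: sumr_ge0 => i _; exact: pr_ge0.
- exact: x01.
- by rewrite mulr_ge0.
move=> L.
apply: (@le_trans _ _ (2 ^+ L * ((16 * L)%:R * (4 * (x1 ^+ L * x2 ^+ L) * (6 * (2 * x1 ^+ L)))))%:E).
  have -> : (16 * L)%:R = (size (iota 1 (16 * L)))%:R :> R by rewrite size_iota.
  apply: mean_scaled_sum.
  - by rewrite exprn_ge0.
  - by move=> i; exact: (mean_box (w1 L) (w2 L) (mc L i)).1.
  - by move=> i q; exact: pr_ge0.
  move=> [|i]; rewrite mem_iota// => _.
  apply: (le_trans (mean_box (w1 L) (w2 L) (mc L i.+1)).2).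
  rewrite lee_fin; apply: ler_wpM2l; first by rewrite !mulr_ge0.
  by apply: pr_close_return; rewrite mulr_gt0// exprn_gt0.
rewrite lee_fin -[leRHS]mulrA; have := hx L; rewrite /eta !exprMn => h.
have -> : 2 ^+ L * ((16 * L)%:R * (4 * (x1 ^+ L * x2 ^+ L) * (6 * (2 * x1 ^+ L)))) =
  16 * 48 * (L%:R * (2 ^+ L * (x1 ^+ L * x1 ^+ L * x2 ^+ L))) by rewrite natrM; ring.
by rewrite ler_wpM2l.
Qed.

(** Two points of the target differ by less than twice its half width. *)
Lemma short_returns_le (a b : R) (ha : 0 < a) (hb : 0 < b) q r L : 0 <= r ->
  r `^ (1 / a) <= x1 ^+ L -> r `^ (1 / b) <= x2 ^+ L ->
  2 ^+ L * short_returns (target a b q r) (16 * L) <= return_weight L q.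
Proof.
move=> r0 h1 h2; rewrite /return_weight ler_wpM2l ?exprn_ge0//.
apply: ler_sum => i _.
have w1 : 0 <= x1 ^+ L by rewrite exprn_ge0// ltW.
have w2 : 0 <= x2 ^+ L by rewrite exprn_ge0// ltW.
have mT := @measurable_target R a b q r.
apply: le_pr.
- apply: measurableI => //.
  exact: (measurable_preimage (measurable_iter i (@measurable_thom R)) mT).
- have mD := @measurable_close_return R i (2 * x1 ^+ L).
  have := measurable_xsection q (measurable_box_rel (x1 ^+ L) (x2 ^+ L) mD).
  by congr measurable; apply/seteqP; split => p; rewrite /xsection/= ?inE.
move=> p [Tp Tip].
have [p1 p2] := target_box ha hb r0 Tp; have [p3 p4] := target_box ha hb r0 Tip.
split; first by split; [exact: lt_le_trans p1 h1|exact: lt_le_trans p2 h2].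
rewrite /close_return/mkset.
have -> : (iter i thom p).1 - p.1 = ((iter i thom p).1 - q.1) - (p.1 - q.1) by ring.
by apply: (le_lt_trans (ler_normB _ _)); lra.
Qed.

End typical_points.

(** * The extreme value law *)

Section extreme_law.
Context (R : realType) (a b : R) (ha : 0 < a) (hb : 0 < b).
Local Notation plane := (measurableTypeR R * measurableTypeR R)%type.
Local Notation prn := (pr (nu R)).
Local Notation beta := (tail_exponent a b).
Local Notation area := (area a b).

(** Any exponent strictly between [1 / (tail_exponent + 1/a)] and [1 / tail_exponent] would
do: below the second one the boxes of half sides [width1^L], [width2^L] contain
the targets used at the times [n] of order [2^L] once [L] is large, and above
the first one [widths_lt1] holds. *)
Definition radius_exp : R := 1 / (beta + 1 / (2 * a)).
Definition radius_ratio : R := 2 `^ (- radius_exp).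

Lemma radius_exp_gt0 : 0 < radius_exp.
Proof. by rewrite divr_gt0// addr_gt0 ?tail_exponent_gt0// divr_gt0// mulr_gt0. Qed.

Lemma radius_exp_lt : radius_exp < 1 / beta.
Proof.
have h1 := tail_exponent_gt0 ha hb; have h2 : 0 < 1 / (2 * a) by rewrite divr_gt0// mulr_gt0.
rewrite /radius_exp !div1r ltf_pV2 ?posrE//; lra.
Qed.

Lemma radius_ratio_gt0 : 0 < radius_ratio. Proof. exact: powR_gt0. Qed.

Lemma powR_gt1 (x s : R) : 1 < x -> 0 < s -> 1 < x `^ s.
Proof.
move=> gt1 s0; have <- : 1 `^ s = 1 :> R by rewrite powR1.
by apply: gt0_ltr_powR; rewrite ?nnegrE//; lra.
Qed.

Lemma widths_lt1 : 2 * ((radius_ratio `^ (1 / a)) ^+ 2 * radius_ratio `^ (1 / b)) < 1.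
Proof.
have h1 := tail_exponent_gt0 ha hb; have ai : 0 < 1 / (2 * a) by rewrite divr_gt0// mulr_gt0.
have ne (x : R) s t : 0 < x -> (s + t == 0) ==> (x != 0).
  by move=> x0; apply/implyP => _; rewrite gt_eqF.
have -> : (radius_ratio `^ (1 / a)) ^+ 2 * radius_ratio `^ (1 / b) = radius_ratio `^ (beta + 1 / a).
  rewrite expr2 -!powRD ?ne ?radius_ratio_gt0//.
  by congr powR; rewrite /tail_exponent; ring.
have gE : radius_exp * (beta + 1 / (2 * a)) = 1.
  by rewrite /radius_exp div1r mulVf// gt_eqF//; lra.
have aE : 1 / a = 1 / (2 * a) + 1 / (2 * a) by field; rewrite gt_eqF.
have -> : radius_ratio `^ (beta + 1 / a) = 2 `^ (- 1 + - (radius_exp * (1 / (2 * a)))).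
  rewrite /radius_ratio -powRrM; congr powR.
  transitivity (- (radius_exp * (beta + 1 / (2 * a))) + - (radius_exp * (1 / (2 * a)))).
    by rewrite aE; ring.
  by rewrite gE.
rewrite powRD ?ne// powR_inv1// mulrA mulfV ?gt_eqF// mul1r powRN.
rewrite ltr_pdivrMr ?powR_gt0// mul1r; apply: powR_gt1; first by rewrite ltr1n.
by rewrite divr_gt0 ?radius_exp_gt0// mulr_gt0.
Qed.

Definition width1 : R := radius_ratio `^ (1 / a).
Definition width2 : R := radius_ratio `^ (1 / b).

Lemma width_bounds : 0 < width1 < 1 /\ 0 < width2 < 1.
Proof.
have r1 : radius_ratio < 1 by rewrite /radius_ratio powRN invf_lt1 ?powR_gt0// powR_gt1 ?radius_exp_gt0//; lra.
have h e : 0 < e -> 0 < radius_ratio `^ (1 / e) < 1.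
  move=> e0; rewrite powR_gt0 ?radius_ratio_gt0//=.
  apply: (@lt_le_trans _ _ (1 `^ (1 / e))); last by rewrite powR1.
  by apply: gt0_ltr_powR; rewrite ?nnegrE ?divr_gt0// ltW// radius_ratio_gt0.
by split; exact: h.
Qed.

Lemma width_pow e L : (radius_ratio `^ (1 / e)) ^+ L = ((2 ^+ L) `^ (- radius_exp)) `^ (1 / e).
Proof.
transitivity ((radius_ratio `^ (1 / e)) `^ L%:R); first by rewrite powR_mulrn// powR_ge0.
rewrite powRAC; congr (_ `^ _); rewrite /radius_ratio powRAC; congr (_ `^ _).
by rewrite powR_mulrn.
Qed.

(** [1 / norming n] is the radius for which the target has measure [1/n].  The
expression [n.-1.+1] is [n] for positive [n], and keeps the value at 0 positive. *)
Definition norming n : R := (area * n.-1.+1%:R) `^ (1 / beta).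

Lemma norming_gt0 n : 0 < norming n.
Proof. by apply: powR_gt0; rewrite mulr_gt0// area_gt0. Qed.

Lemma target_Lambda q d r : 0 <= r -> d <= q.1 <= 1 - d -> d <= q.2 <= 1 - d ->
  r `^ (1 / a) <= d -> r `^ (1 / b) <= d -> target a b q r `<=` @Lambda R.
Proof.
move=> r0 /andP[? ?] /andP[? ?] ra rb [x y] /(target_box ha hb r0) /=.
rewrite !ltr_distl => -[/andP[? ?] /andP[? ?]].
by split; rewrite /= in_itv/=; apply/andP; split; lra.
Qed.

(** The radii decay like [n^(- 1 / tail_exponent)], faster than [n^(- radius_exp)]. *)
Lemma radius_le (kappa : R) : 0 < kappa -> exists K : R, forall n L, (0 < n)%N ->
  K <= n%:R -> 2 ^+ L <= 2 * n%:R :> R -> kappa / norming n <= (2 ^+ L) `^ (- radius_exp).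
Proof.
move=> k0; have g0 := radius_exp_gt0; have b0 := tail_exponent_gt0 ha hb.
pose del := 1 / beta - radius_exp; have del0 : 0 < del by rewrite subr_gt0 radius_exp_lt.
pose K := kappa * 2 `^ radius_exp / area `^ (1 / beta).
have ar := area_gt0 ha hb.
have K0 : 0 <= K by rewrite divr_ge0 ?powR_ge0// mulr_ge0 ?powR_ge0// ltW.
exists (K `^ (1 / del)) => n L n0 Kn Ln.
have N0 : 0 < n%:R :> R by rewrite ltr0n.
rewrite powRN ler_pdivrMr ?norming_gt0// mulrC ler_pdivlMr ?powR_gt0 ?exprn_gt0//.
apply: (@le_trans _ _ (kappa * (2 * n%:R) `^ radius_exp)).
  apply: ler_wpM2l; first exact: ltW.
  apply: ge0_ler_powR; [exact: ltW| | |exact: Ln]; rewrite nnegrE ?exprn_ge0//.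
rewrite /norming prednK// (powRM _ (ler0n R 2) (ler0n R n)) (powRM _ (ltW ar) (ler0n R n)).
have -> : n%:R `^ (1 / beta) = n%:R `^ del * n%:R `^ radius_exp :> R.
  rewrite -powRD; first by congr powR; rewrite /del; ring.
  by apply/implyP => _; rewrite gt_eqF.
rewrite mulrA [leRHS]mulrA ler_wpM2r ?powR_ge0//.
have hK : K <= n%:R `^ del.
  rewrite -(powRVK del0 K0); apply: ge0_ler_powR; rewrite ?nnegrE ?powR_ge0//.
  exact: ltW.
by move: hK; rewrite /K ler_pdivrMr ?powR_gt0// [leRHS]mulrC.
Qed.

(** Bounds [n] times the error of [local_correlation] for [2^(L - 1) <= n < 2^L], plus the
quadratic term of [hitting_time_law]. *)
Definition law_error tau q L : R := return_weight width1 width2 L q + 104 * 2^-1 ^+ L +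
  2 * tau ^+ 2 * (16 * (L%:R * 2^-1 ^+ L) + 2^-1 ^+ L).

Lemma law_error_cvg0 tau q : return_weight width1 width2 L q @[L --> \oo] --> 0 ->
  law_error tau q L @[L --> \oo] --> 0.
Proof.
move=> hret.
have half : 2^-1 ^+ L @[L --> \oo] --> (0 : R).
  have := @cvg_geometric R 1 2^-1; rewrite ger0_norm// invf_lt1// ltr1n => /(_ isT).
  by apply: cvg_trans; apply: near_eq_cvg; apply: nearW => L /=; rewrite mul1r.
have Lhalf : L%:R * 2^-1 ^+ L @[L --> \oo] --> (0 : R).
  have [|C [x [/andP[x0 x11] C0 hx]]] := @natmul_geometric R 2^-1.
    by apply/andP; split; [rewrite invr_gt0|rewrite invf_lt1// ltr1n].
  apply: (@squeeze_cvgr _ _ _ _ (cst 0) (geometric C x)).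
  - by apply: nearW => L; rewrite /= hx andbT mulr_ge0// exprn_ge0.
  - exact: cvg_cst.
  - by apply: cvg_geometric; rewrite ger0_norm.
rewrite -[X in _ --> X](_ : 0 + 104 * 0 + 2 * tau ^+ 2 * (16 * 0 + 0) = 0); last by ring.
apply: cvgD; first apply: cvgD => //; first by apply: cvgMr; exact: half.
by apply: cvgMr; apply: cvgD => //; apply: cvgMr.
Qed.

Lemma hitting_law_error q (d r tau : R) n L : (0 < n)%N -> 0 < tau ->
  d <= q.1 <= 1 - d -> d <= q.2 <= 1 - d -> width1 ^+ L <= d -> width2 ^+ L <= d ->
  0 < r -> r <= (2 ^+ L) `^ (- radius_exp) -> area * r `^ beta = tau / n%:R ->
  (n <= 2 ^ L)%N -> 2 ^+ L <= 2 * n%:R :> R ->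
  `|prn (avoids (target a b q r) 0 n) - expR (- tau)| <= law_error tau q L.
Proof.
move=> n0 tau0 q1 q2 d1 d2 r0 rL e nL Ln.
have N0 : 0 < n%:R :> R by rewrite ltr0n.
have rp c : 0 < c -> r `^ (1 / c) <= (radius_ratio `^ (1 / c)) ^+ L.
  move=> c0; rewrite width_pow; apply: ge0_ler_powR; rewrite ?nnegrE ?powR_ge0//.
    by rewrite divr_ge0// ltW.
  exact: ltW.
have ra := rp a ha; have rb := rp b hb.
have tL := target_Lambda (ltW r0) q1 q2 (le_trans ra d1) (le_trans rb d2).
have mT := @measurable_target R a b q r.
have pT := pr_target ha hb r0 tL; rewrite e in pT.
have nt : n%:R * prn (target a b q r) = tau by rewrite pT mulrC divfK// gt_eqF.
have := @hitting_time_law R (target a b q r) mT n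
  (short_returns (target a b q r) (16 * L) + 104 * 4^-1 ^+ L
    + (16 * L)%:R * prn (target a b q r) ^+ 2).
rewrite nt => /(_ _)/le_trans; apply.
  move=> k kn; apply: local_correlation => //.
  apply: mixing => //; first exact: slices_target.
  by apply: (leq_trans (leq_subr _ _)); exact: leq_trans (ltnW kn) nL.
have [[x10 x11] [x20 x21]] : (0 < width1 /\ width1 < 1) /\ (0 < width2 /\ width2 < 1).
  by have [/andP[? ?] /andP[? ?]] := width_bounds.
have := @short_returns_le R width1 width2 x10 x20 a b ha hb q r L (ltW r0) ra rb.
set sr := short_returns _ _; rewrite pT => hsr.
have sr0 : 0 <= sr by apply: sumr_ge0 => i _; exact: pr_ge0.
set X : R := 2 ^+ L in hsr Ln *; set z : R := 2^-1 ^+ L.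
have X0 : 0 < X by exact: exprn_gt0.
have xz : X * z = 1 by rewrite /X /z -exprMn divff// expr1n.
have z0 : 0 < z by exact: exprn_gt0.
have nX : n%:R <= X by rewrite /X -natrX ler_nat.
have e4 : 4^-1 ^+ L = z ^+ 2 by rewrite /z exprAC; congr (_ ^+ _); field.
have ni : n%:R^-1 <= 2 * z.
  rewrite -[leLHS]mul1r ler_pdivrMr//.
  have : X * z <= 2 * n%:R * z by rewrite ler_wpM2r// ltW.
  by rewrite xz => h; lra.
rewrite /law_error -/z e4.
apply: (@le_trans _ _ (n%:R * sr + 104 * (n%:R * z ^+ 2) +
   tau ^+ 2 * n%:R^-1 * ((16 * L)%:R + 1))).
  have -> : n%:R * (sr + 104 * z ^+ 2 + (16 * L)%:R * (tau / n%:R) ^+ 2 + (tau / n%:R) ^+ 2)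
    = n%:R * sr + 104 * (n%:R * z ^+ 2) + tau ^+ 2 * n%:R^-1 * ((16 * L)%:R + 1).
    by field; rewrite gt_eqF.
  exact: lexx.
apply: lerD; first apply: lerD.
- by apply: le_trans hsr; rewrite ler_wpM2r.
- apply: ler_wpM2l => //; rewrite expr2 mulrA -[leRHS]mul1r.
  apply: ler_wpM2r; first exact: ltW.
  by apply: (le_trans (ler_wpM2r (ltW z0) nX)); rewrite xz.
have -> : 2 * tau ^+ 2 * (16 * (L%:R * z) + z) = tau ^+ 2 * (2 * z) * ((16 * L)%:R + 1).
  by rewrite natrM; ring.
by rewrite ler_wpM2r ?addr_ge0// ler_wpM2l// sqr_ge0.
Qed.

(** [hitting_law_error] along [L = trunc_log 2 n + 1].  The target must also fit into
the unit square, which holds for large [n] as the centre is an interior point. *)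
Lemma extreme_law q (kappa : R) : 0 < q.1 < 1 -> 0 < q.2 < 1 -> 0 < kappa ->
  return_weight width1 width2 L q @[L --> \oo] --> 0 ->
  prn (avoids (target a b q (kappa / norming n)) 0 n) @[n --> \oo]
    --> expR (- (kappa `^ beta)).
Proof.
move=> /andP[q1 q1'] /andP[q2 q2'] k0 hret.
have [/andP[x10 x11] /andP[x20 x21]] := width_bounds.
pose d := Num.min (Num.min q.1 (1 - q.1)) (Num.min q.2 (1 - q.2)).
have d0 : 0 < d by rewrite !lt_min q1 q2 !subr_gt0 q1' q2'.
have [dq1 dq2] : d <= q.1 <= 1 - d /\ d <= q.2 <= 1 - d.
  have : d <= d by [].
  rewrite {2}/d !le_min => /andP[/andP[? ?] /andP[? ?]].
  by split; apply/andP; split; lra.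
pose tau := kappa `^ beta; have tau0 : 0 < tau by exact: powR_gt0.
have small x : 0 < x -> x < 1 -> \forall L \near \oo, x ^+ L <= d.
  move=> x0 xl; have := @cvg_geometric R 1 x; rewrite ger0_norm ?ltW// => /(_ xl).
  move=> /cvgrPdist_le /(_ d d0); apply: filterS => L /=.
  by rewrite sub0r normrN mul1r ger0_norm// exprn_ge0// ltW.
have [K hK] := radius_le k0.
apply/cvgrPdist_lt => eps eps0.
have := law_error_cvg0 tau hret => /cvgrPdist_lt/(_ eps eps0) herr.
have [L0 _ HL0] : \forall L \near \oo,
    [/\ `|0 - law_error tau q L| < eps, width1 ^+ L <= d & width2 ^+ L <= d].
  near=> L; split; near: L; [exact: herr|exact: small|exact: small].
near=> n.
have hn : (2 ^ L0 <= n)%N by near: n; exact: nbhs_infty_ge.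
have hKn : K <= n%:R by near: n; exact: nbhs_infty_ger.
have n0 : (0 < n)%N by apply: leq_trans hn; rewrite expn_gt0.
pose L := (trunc_log 2 n).+1.
have /andP[tl1 tl2] := trunc_log_bounds (isT : (1 < 2)%N) n0.
have L0L : (L0 <= L)%N by apply: leqW; exact: trunc_log_max.
have [he h1 h2] := HL0 L L0L.
have Ln : 2 ^+ L <= 2 * n%:R :> R by rewrite -natrX -natrM ler_nat expnS leq_pmul2l.
have r0 : 0 < kappa / norming n by rewrite divr_gt0// norming_gt0.
rewrite distrC.
apply: le_lt_trans he; rewrite sub0r normrN; apply: le_trans (ler_norm _).
apply: (@hitting_law_error q d) => //.
- exact: hK.
- have ar := area_gt0 ha hb; have b0 := tail_exponent_gt0 ha hb.
  have N0 : 0 < n%:R :> R by rewrite ltr0n.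
  rewrite powRM ?ltW ?invr_gt0 ?norming_gt0//.
  rewrite -powR_inv1 ?ltW ?norming_gt0// /norming prednK// powRAC powRVK// ?mulr_ge0 ?ltW//.
  rewrite powR_inv1 ?mulr_ge0 1?ltW// -/tau; field.
  by rewrite !gt_eqF.
- exact: ltnW.
Unshelve. all: by end_near.
Qed.

End extreme_law.

(** * Uniqueness of the tail index *)

Section convergence_of_types.
Context (R : realType) d (T : measurableType d) (P : probability T R) (X : nat -> T -> R).
Context (mX : forall n y, measurable [set w | running_max X n w <= y]).

Definition max_cdf n y : R := pr P [set w | running_max X n w <= y].

Lemma max_cdf_homo n : {homo max_cdf n : x y / x <= y}.
Proof. by move=> x y xy; apply: le_pr => // w /= /le_trans; apply. Qed.

Lemma normalized_event (s m x : R) n : 0 < s ->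
  [set w | s * (running_max X n w - m) <= x] = [set w | running_max X n w <= m + x / s].
Proof.
move=> s0; apply/seteqP; split => w /=.
  by rewrite -ler_pdivlMl// mulrC lerBlDl.
by rewrite -[in X in X -> _]lerBlDl ler_pdivlMr// mulrC.
Qed.

Lemma cvg_max_cdf (s m : nat -> R) (x l : R) : (forall n, 0 < s n) ->
  P [set w | s n * (running_max X n w - m n) <= x] @[n --> \oo] --> l%:E <->
  max_cdf n (m n + x / s n) @[n --> \oo] --> l.
Proof.
move=> s0.
have e n : P [set w | s n * (running_max X n w - m n) <= x] = (max_cdf n (m n + x / s n))%:E.
  by rewrite normalized_event// prE.
under eq_fun do rewrite e.
split=> [/fine_cvgP[_]|h]; last by apply/fine_cvgP; split => //; apply: nearW.
exact.
Qed.

(** Monotonicity of the distribution functions and strict monotonicity of the limit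
prevent [v n] from staying away from [y]. *)
Lemma quantile_cvg (G : R -> R) (s m v : nat -> R) (y : R) :
  (forall u v, u < v -> v < 0 -> G u < G v) -> (forall n, 0 < s n) ->
  (forall u, max_cdf n (m n + u / s n) @[n --> \oo] --> G u) -> y < 0 ->
  max_cdf n (m n + v n / s n) @[n --> \oo] --> G y -> v n @[n --> \oo] --> y.
Proof.
move=> Ginc s0 hG y0 hv; apply/cvgrPdist_lt => e e0.
pose f := Num.min e (- y / 2).
have f0 : 0 < f by rewrite lt_min e0 divr_gt0// oppr_gt0.
have fe : f <= e by rewrite ge_min lexx.
have fy : y + f < 0.
  have : f <= - y / 2 by rewrite ge_min lexx orbT.
  by move=> ?; lra.
have G1 : G y < G (y + f) by apply: Ginc => //; lra.
have G2 : G (y - f) < G y by apply: Ginc => //; lra.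
have mono n u w : u <= w -> max_cdf n (m n + u / s n) <= max_cdf n (m n + w / s n).
  by move=> uw; apply: max_cdf_homo; rewrite lerD2l ler_wpM2r// invr_ge0 ltW.
pose m1 := (G y + G (y + f)) / 2; pose m2 := (G y + G (y - f)) / 2.
near=> n.
have a1 : max_cdf n (m n + v n / s n) < m1.
  by near: n; apply: (cvgr_lt (G y)) => //; rewrite /m1; lra.
have a2 : m2 < max_cdf n (m n + v n / s n).
  by near: n; apply: (cvgr_gt (G y)) => //; rewrite /m2; lra.
have a3 : m1 < max_cdf n (m n + (y + f) / s n).
  by near: n; apply: (cvgr_gt (G (y + f))) => //; rewrite /m1; lra.
have a4 : max_cdf n (m n + (y - f) / s n) < m2.
  by near: n; apply: (cvgr_lt (G (y - f))) => //; rewrite /m2; lra.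
have b1 : v n < y + f.
  by rewrite ltNge; apply/negP => /(mono n) h; move: (lt_trans a1 a3); rewrite ltNge h.
have b2 : y - f < v n.
  by rewrite ltNge; apply/negP => /(mono n) h; move: (lt_trans a4 a2); rewrite ltNge h.
by rewrite ltr_distl; clear - b1 b2 fe; apply/andP; split; lra.
Unshelve. all: by end_near.
Qed.

(** Passing from one normalization to the other is an affine map for each [n], so it
keeps equal spacing, and this survives in the limit. *)
Lemma quantiles_equispaced (G : R -> R) (s m s' m' : nat -> R) (p1 p2 p3 y1 y2 y3 : R) :
  (forall u v, u < v -> v < 0 -> G u < G v) -> (forall n, 0 < s n) -> (forall n, 0 < s' n) ->
  (forall u, max_cdf n (m n + u / s n) @[n --> \oo] --> G u) ->
  y1 < 0 -> y2 < 0 -> y3 < 0 -> p1 + p3 = 2 * p2 ->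
  max_cdf n (m' n + p1 / s' n) @[n --> \oo] --> G y1 ->
  max_cdf n (m' n + p2 / s' n) @[n --> \oo] --> G y2 ->
  max_cdf n (m' n + p3 / s' n) @[n --> \oo] --> G y3 -> y1 + y3 = 2 * y2.
Proof.
move=> Ginc s0 s0' hG y10 y20 y30 p123 h1 h2 h3.
pose v p n := s n * (m' n + p / s' n - m n).
have vE p n : m n + v p n / s n = m' n + p / s' n.
  by rewrite /v mulrAC mulfV ?gt_eqF// mul1r addrC subrK.
have cv p y : y < 0 -> max_cdf n (m' n + p / s' n) @[n --> \oo] --> G y ->
    v p n @[n --> \oo] --> y.
  move=> y0 h; apply: (quantile_cvg Ginc s0 hG y0).
  by under eq_fun do rewrite vE.
have c1 := cv _ _ y10 h1; have c2 := cv _ _ y20 h2; have c3 := cv _ _ y30 h3.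
have c13 : (v p1 n + v p3 n) @[n --> \oo] --> y1 + y3 by exact: cvgD.
have c22 : (2 * v p2 n) @[n --> \oo] --> 2 * y2 by exact: cvgMr.
apply: (cvg_unique _ c13); first exact: norm_hausdorff.
have -> : (fun n => v p1 n + v p3 n) = (fun n => 2 * v p2 n).
  apply/funext => n; rewrite /v; have -> : p3 = 2 * p2 - p1 by lra.
  by field; rewrite gt_eqF.
exact: c22.
Qed.

Definition weibull (beta x : R) : R := if x < 0 then expR (- (- x) `^ beta) else 1.

Lemma gev_weibull (beta x : R) : 0 < beta ->
  gev (- 1) (1 / beta) (- (1 / beta)) x = weibull beta x.
Proof.
move=> b0; rewrite /gev /weibull.
have -> : 1 + - (1 / beta) * ((x - -1) / (1 / beta)) = - x by field; rewrite gt_eqF.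
have xi0 : - (1 / beta) < 0 by rewrite oppr_lt0 divr_gt0.
rewrite (lt_eqF xi0) oppr_gt0 [0 < - (1 / beta)]ltNge (ltW xi0) /=.
case: ifPn => [_|_]; last by [].
by have -> : - (1 / - (1 / beta)) = beta by rewrite invrN mulrN opprK !div1r invrK.
Qed.

Lemma weibull_lt (beta u v : R) : 0 < beta -> u < v -> v < 0 -> weibull beta u < weibull beta v.
Proof.
move=> b0 uv v0; rewrite /weibull v0 (lt_trans uv v0) ltr_expR ltrN2.
by apply: gt0_ltr_powR => //; rewrite ?nnegrE; lra.
Qed.

(** The quantile of level [exp (- t)]. *)
Lemma weibull_root (beta t : R) : 0 < beta -> 0 < t -> weibull beta (- (t `^ (1 / beta))) = expR (- t).
Proof.
move=> b0 t0; rewrite /weibull oppr_lt0 powR_gt0// opprK powRVK//; exact: ltW.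
Qed.

(** If the [g]-th powers of 1, 2, 3, 4 are equally spaced, then [p = 2^g] satisfies
[p^2 - 3 p + 2 = 0], as [4^g = p^2]; the root 1 is [g = 0]. *)
Lemma equispaced_powers (g : R) : g != 0 -> 1 + 3 `^ g = 2 * 2 `^ g ->
  2 `^ g + 4 `^ g = 2 * 3 `^ g -> g = 1.
Proof.
move=> g0 e1 e2; pose p : R := 2 `^ g.
have e4 : 4 `^ g = p ^+ 2 :> R.
  by rewrite expr2 -powRM//; congr (_ `^ _); ring.
have : (p - 1) * (p - 2) = 0 by rewrite e4 -/p in e2; rewrite -/p in e1; nra.
have l2 : 0 < ln 2 :> R by rewrite ln_gt0// ltr1n.
have lp : ln p = g * ln 2 by rewrite /p ln_powR.
move/eqP; rewrite mulf_eq0 !subr_eq0 => /orP[/eqP p1|/eqP p2].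
  move: lp; rewrite p1 ln1 => /esym/eqP; rewrite mulf_eq0 (negbTE g0) gt_eqF//.
apply: (mulIf (lt0r_neq0 l2)); by rewrite -lp p2 mul1r.
Qed.

(** If [xi = 0], the quantiles would make 1, 2, 4 equally spaced.  Otherwise the points
where the argument of the GEV law is [t = 1, 2, 3, 4] have quantiles
[- t^g] with [g = - 1 / (xi beta)], and [equispaced_powers] gives [g = 1]. *)
Lemma tail_index_unique (beta xi : R) (s m : nat -> R) : 0 < beta -> (forall n, 0 < s n) ->
  (forall u, max_cdf n (m n + u / s n) @[n --> \oo] --> weibull beta u) ->
  tail_index P X xi -> - (1 / xi) = beta.
Proof.
move=> b0 s0 hG [mu [sigma [sig0 [s' [m' [s0' hH]]]]]].
have {}hH x : max_cdf n (m' n + x / s' n) @[n --> \oo] --> gev mu sigma xi x.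
  by apply/(cvg_max_cdf _ _ _ s0').
have Ginc u v : u < v -> v < 0 -> weibull beta u < weibull beta v by exact: weibull_lt.
have root_lt0 t : 0 < t -> - (t `^ (1 / beta)) < 0 :> R by move=> ?; rewrite oppr_lt0 powR_gt0.
have tri p1 p2 p3 t1 t2 t3 : 0 < t1 -> 0 < t2 -> 0 < t3 -> p1 + p3 = 2 * p2 ->
    gev mu sigma xi p1 = expR (- t1) -> gev mu sigma xi p2 = expR (- t2) ->
    gev mu sigma xi p3 = expR (- t3) ->
    t1 `^ (1 / beta) + t3 `^ (1 / beta) = 2 * t2 `^ (1 / beta).
  move=> t10 t20 t30 p123 g1 g2 g3.
  have h1 := hH p1; have h2 := hH p2; have h3 := hH p3.
  rewrite g1 -(weibull_root b0 t10) in h1.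
  rewrite g2 -(weibull_root b0 t20) in h2.
  rewrite g3 -(weibull_root b0 t30) in h3.
  have := quantiles_equispaced Ginc s0 s0' hG (root_lt0 _ t10) (root_lt0 _ t20)
    (root_lt0 _ t30) p123 h1 h2 h3.
  by rewrite -opprD mulrN => /oppr_inj.
have [xi0|xi0] := eqVneq xi 0.
  pose t (j : nat) : R := (2 ^+ j) `^ beta.
  have t0 j : 0 < t j by rewrite powR_gt0// exprn_gt0.
  have tE j : (t j) `^ (1 / beta) = 2 ^+ j.
    rewrite /t -powRrM div1r mulfV ?gt_eqF// powRr1//; exact: exprn_ge0.
  pose p (j : nat) := mu - sigma * ln (t j).
  have gp j : gev mu sigma xi (p j) = expR (- t j).
    rewrite /gev xi0 eqxx; congr expR; congr (- _).
    have -> : - ((p j - mu) / sigma) = ln (t j) by rewrite /p; field; rewrite gt_eqF.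
    by rewrite lnK// posrE.
  have lt j : ln (t j) = j%:R * (beta * ln 2).
    by rewrite /t ln_powR lnXn// -mulr_natl; ring.
  have := tri (p 0%N) (p 1%N) (p 2%N) _ _ _ (t0 0%N) (t0 1%N) (t0 2%N).
  rewrite !gp !tE => /(_ _ erefl erefl erefl) h.
  have : (2 ^+ 0 + 2 ^+ 2 = 2 * 2 ^+ 1 :> R) by apply: h; rewrite /p !lt; ring.
  by rewrite expr0 expr1 => ?; lra.
pose g := - (1 / xi) * (1 / beta).
pose p (t : R) := mu + sigma * ((t - 1) / xi).
have gp t : 0 < t -> gev mu sigma xi (p t) = expR (- (t `^ (- (1 / xi)))).
  move=> t0; rewrite /gev (negbTE xi0).
  have -> : 1 + xi * ((p t - mu) / sigma) = t by rewrite /p; field; rewrite xi0 gt_eqF.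
  by rewrite t0.
have pw t : (t `^ (- (1 / xi))) `^ (1 / beta) = t `^ g by rewrite -powRrM.
have tri' t1 t2 t3 : 0 < t1 -> 0 < t2 -> 0 < t3 -> t1 + t3 = 2 * t2 ->
    t1 `^ g + t3 `^ g = 2 * t2 `^ g.
  move=> t10 t20 t30 t123; rewrite -!pw.
  apply: (tri (p t1) (p t2) (p t3)); rewrite ?powR_gt0 ?gp//.
  rewrite /p; have -> : t3 = 2 * t2 - t1 by lra.
  by field.
have g0 : g != 0 by rewrite mulf_neq0// ?oppr_eq0 div1r invr_neq0// gt_eqF.
have g1 : g = 1.
  apply: equispaced_powers => //.
    by have := @tri' 1 2 3; rewrite powR1; apply; lra.
  by apply: tri'; lra.
have : g * beta = beta by rewrite g1 mul1r.
by rewrite /g -mulrA (div1r beta) mulVf ?gt_eqF// mulr1.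
Qed.

End convergence_of_types.

(** * The process of the theorem *)

Section cat_map.
Context (R : realType) (a b : R) (ha : 0 < a) (hb : 0 < b).
Local Notation line := (measurableTypeR R).
Local Notation plane := (measurableTypeR R * measurableTypeR R)%type.
Local Notation prn := (pr (nu R)).
Local Notation beta := (tail_exponent a b).

Lemma bigmax_leE (s : seq nat) (f : nat -> R) (x0 y : R) :
  (\big[Num.max/x0]_(i <- s) f i <= y) = (x0 <= y) && all (fun i => f i <= y) s.
Proof.
by elim: s => [|i s IH]; rewrite ?big_nil ?andbT// big_cons ge_max IH andbCA.
Qed.

(** At [n = 0] the maximum is the first term, as for [n = 1], hence [n.-1.+1]. *)
Lemma running_max_le (T : Type) (X : nat -> T -> R) n w y :
  (running_max X n w <= y) <-> (forall i, (0 < i <= n.-1.+1)%N -> X i w <= y).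
Proof.
rewrite /running_max bigmax_leE; split.
  move=> /andP[x1 /allP h] i /andP[i0]; case: n h => [|n] h iN.
    by have -> : i = 1%N by apply/eqP; rewrite eqn_leq iN i0.
  by apply: h; rewrite mem_index_iota i0 ltnS.
move=> h; apply/andP; split; first exact: h.
apply/allP => i; rewrite mem_index_iota => /andP[i0 iN]; apply: h.
by rewrite i0 (leq_trans _ (leqSpred n)).
Qed.

Lemma process_event q n y :
  [set w | running_max (process a b q) n w <= y] = avoids (target a b q (1 - y)) 0 n.-1.+1.
Proof.
have e i w : (process a b q i w <= y) = ~~ (`|(iter i (@thom R) w).1 - q.1| `^ a +
    `|(iter i (@thom R) w).2 - q.2| `^ b < 1 - y).
  by rewrite /process /phi -leNgt; apply/idP/idP => ?; lra.
apply/seteqP; split => w.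
  move=> /running_max_le h i /h; rewrite e => /negP; exact.
move=> h; apply/running_max_le => i /h hi; rewrite e; exact/negP.
Qed.

Lemma process_law q : 0 < q.1 < 1 -> 0 < q.2 < 1 ->
  return_weight (width1 a b) (width2 a b) L q @[L --> \oo] --> 0 -> forall u,
  max_cdf (nu R) (process a b q) n (1 + u / norming a b n) @[n --> \oo] --> weibull beta u.
Proof.
move=> q1 q2 hret u; rewrite /weibull.
have ev n : max_cdf (nu R) (process a b q) n (1 + u / norming a b n) =
    prn (avoids (target a b q (- u / norming a b n)) 0 n.-1.+1).
  have -> : - u / norming a b n = 1 - (1 + u / norming a b n).
    by rewrite opprD addrA subrr add0r mulNr.
  exact: (congr1 prn (process_event q n (1 + u / norming a b n))).
under eq_fun do rewrite ev.
case: ifPn => [u0|]; last rewrite -leNgt => u0.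
  have k0 : 0 < - u by rewrite oppr_gt0.
  have := extreme_law ha hb q1 q2 k0 hret.
  apply: cvg_trans; apply: near_eq_cvg.
  by near=> n; rewrite prednK//; near: n; exact: nbhs_infty_gt.
have e0 n : avoids (target a b q (- u / norming a b n)) 0 n.-1.+1 = setT.
  apply/seteqP; split => // w _ i _; rewrite /target/mkset => h.
  have : - u / norming a b n <= 0 by rewrite mulNr oppr_le0 divr_ge0// ltW// norming_gt0.
  have := powR_ge0 `|(iter i (@thom R) w).1 - q.1| a.
  have := powR_ge0 `|(iter i (@thom R) w).2 - q.2| b.
  by move=> ? ? ?; lra.
under eq_fun do rewrite e0 prT.
exact: cvg_cst.
Unshelve. all: by end_near.
Qed.

Lemma ae_interior : {ae (nu R), forall q : R * R, 0 < q.1 < 1 /\ 0 < q.2 < 1}.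
Proof.
pose J : set line := `]0, 1[%classic.
have mJ : measurable (~` J : set line) by apply: measurableC; exact: measurable_itv.
have uJ : (unif (~` J) <= 0%:E)%E.
  apply: (@le_trans _ _ (@lebesgue_measure R [set 0])); last by rewrite lebesgue_measure_set1.
  apply: le_measure; rewrite ?inE; [|exact: measurable_set1|].
    by apply: measurableI => //; exact: measurable_itv.
  move=> x []; rewrite /J/= !in_itv/= => /negP; rewrite negb_and -!leNgt => + /andP[x0 x1].
  move=> /orP[x0'|]; last by rewrite leNgt x1.
  by apply/eqP; rewrite eq_le x0 x0'.
pose N1 : set plane := [set q | (~` J) q.1]; pose N2 : set plane := [set q | (~` J) q.2].
have mN1 : measurable N1 by have := @measurable_fst _ _ line line measurableT _ mJ; rewrite setTI.
have mN2 : measurable N2 by have := @measurable_snd _ _ line line measurableT _ mJ; rewrite setTI.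
have n1 : (nu R).-negligible N1.
  apply/negligibleP => //; apply/eqP; rewrite eq_le measure_ge0 andbT.
  exact: nu_le_ysec.
have n2 : (nu R).-negligible N2.
  apply/negligibleP => //; apply/eqP; rewrite eq_le measure_ge0 andbT.
  exact: nu_le_xsec.
apply: negligibleS (negligibleU n1 n2) => q /=.
move=> /not_andP[h|h]; [left|right]; rewrite /N1/N2/J/= in_itv/=; exact: h.
Qed.
End cat_map.

Theorem mainTheorem2 (R : realType) (a b : R) (ha : 0 < a) (hb : 0 < b) :
  {ae (nu R), forall pM : R * R,
    (exists xi : R, tail_index (nu R) (process a b pM) xi) /\
    (forall xi : R, tail_index (nu R) (process a b pM) xi ->
       - (1 / xi) = 1 / a + 1 / b)}.
Proof.
have [/andP[x10 x11] /andP[x20 x21]] := width_bounds ha hb.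
have hret := ae_return_weight x10 x20 (widths_lt1 ha hb).
have b0 := tail_exponent_gt0 ha hb.
have FF : Filter (nbhs (almost_everywhere (nu R))) by exact: (ae_filter_ringOfSetsType (nu R)).
apply: filterS2 (ae_interior R) hret => q [q1 q2] hq.
have mE n y : measurable ([set w | running_max (process a b q) n w <= y] :
    set (measurableTypeR R * measurableTypeR R)).
  by rewrite process_event; apply: measurable_avoids; exact: measurable_target.
have s0 := norming_gt0 ha hb.
have law := process_law ha hb q1 q2 hq.
split; last first.
  move=> xi; exact: (tail_index_unique mE b0 s0 law).
exists (- (1 / tail_exponent a b)), (- 1), (1 / tail_exponent a b); split; first by rewrite divr_gt0.
exists (norming a b), (fun=> 1); split => // x.
rewrite gev_weibull//.
exact: (proj2 (cvg_max_cdf (nu R) mE (fun=> 1) x (weibull (tail_exponent a b) x) s0) (law x)).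
Qed.
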